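(* Let $L=\mathbb Q[x]\rtimes\mathbb Q t$ be the rational lamplighter Lie algebra and let $\widehat L=\varprojlim_n L/L^n$ be its pronilpotent completion. Then for every integer $q\ge 2$, the homology $H_q(\widehat L)$ is uncountable. In particular, the cohomological dimension of $\widehat L$ is infinite.
   Context: The rational lamplighter Lie algebra $L=\mathbb Q[x]\rtimes\mathbb Q t$ is the semidirect product of the abelian Lie algebras $\mathbb Q[x]$ and $\mathbb Q t$, with $[p,t]=x\cdot p$ for every polynomial $p$. Its lower central series is $L^1=L$, $L^n=[L,L^{n-1}]$ for $n\ge2$. Elements of $\widehat L=\varprojlim_n L/L^n$ are the formal series $\lambda t+\sum_{r\ge 0}\lambda_r x^r$ with $\lambda,\lambda_r\in\mathbb Q$, i.e. $\widehat L=\mathbb Q[[x]]\rtimes\mathbb Q t$ with $[f,t]=x\cdot f$ for $f\in\mathbb Q[[x]]$. The homology of a rational Lie algebra $E$ is $H_q(E)=\operatorname{Tor}^{UE}_q(\mathbb Q,\mathbb Q)$, where $UE$ is the (ordinary, uncompleted) universal enveloping algebra and $\mathbb Q$ is the trivial module. The cohomological dimension of $E$ is the supremum of the $q$ such that $\operatorname{Ext}_{UE}^q(\mathbb Q,M)\ne 0$ for some $UE$-module $M$. *)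

(* Defs.v *)
From HB Require Import structures.
From mathcomp Require Import all_boot all_order all_algebra.
From mathcomp Require Import finmap monalg ring.
From mathcomp Require Import boolp classical_sets functions cardinality.
From mathcomp Require Import constructive_ereal.

Set Implicit Arguments.
Unset Strict Implicit.
Unset Printing Implicit Defensive.

Import Order.TTheory GRing.Theory Num.Theory.
Local Open Scope ring_scope.
Local Open Scope quotient_scope.
Local Open Scope classical_set_scope.

Section QuotientGroup.
Variable V : zmodType.

Inductive subgroup_gen (G : set V) : set V :=
| sg_gen x : G x -> subgroup_gen G x
| sg_zero : subgroup_gen G 0
| sg_sub x y : subgroup_gen G x -> subgroup_gen G y -> subgroup_gen G (x - y).

Definition subgroup_gen_pred (G : set V) : {pred V} :=
  fun x : V => `[< subgroup_gen G x >].

Variable G : set V.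

Lemma subgroup_gen_zmod_closed : zmod_closed (subgroup_gen_pred G).
Proof.
split=> [|x y /asboolP Gx /asboolP Gy]; apply/asboolP.
  exact: sg_zero.
exact: sg_sub.
Qed.

HB.instance Definition _ :=
  GRing.isZmodClosed.Build V (subgroup_gen_pred G) subgroup_gen_zmod_closed.

(* V modulo the subgroup generated by G. *)
Definition quo := Quotient.quot (subgroup_gen_pred G).
HB.instance Definition _ := Choice.on quo.
HB.instance Definition _ := GRing.Zmodule.on quo.

Definition quo_pi : V -> quo := \pi_(Quotient.quot (subgroup_gen_pred G)).
HB.instance Definition _ := GRing.Additive.on quo_pi.

Lemma quo_piP x y : quo_pi x = quo_pi y <-> subgroup_gen G (x - y).
Proof.
split=> [/eqP|Gxy]; first by rewrite -Quotient.idealrBE => /asboolP.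
by apply/eqP; rewrite -Quotient.idealrBE; apply/asboolP.
Qed.

Lemma quo_piK (x : quo) : quo_pi (repr x) = x.
Proof. exact: reprK. Qed.

Variables (W : zmodType) (f : {additive V -> W}).
Hypothesis f0 : forall x, G x -> f x = 0.

Lemma subgroup_gen_lift x : subgroup_gen G x -> f x = 0.
Proof.
elim=> [y /f0 //||y z _ fy _ fz]; first exact: raddf0.
by rewrite raddfB fy fz subrr.
Qed.

End QuotientGroup.

Definition quo_lift (V W : zmodType) (G : set V) (f : {additive V -> W})
  (f0 : forall x, G x -> f x = 0) (x : quo G) : W := f (repr x).

Lemma quo_lift_pi (V W : zmodType) (G : set V) (f : {additive V -> W})
  (f0 : forall x, G x -> f x = 0) x : quo_lift f0 (quo_pi G x) = f x.
Proof.
apply/eqP; rewrite -subr_eq0 -raddfB; apply/eqP.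
by apply: (subgroup_gen_lift f0); apply/quo_piP; rewrite quo_piK.
Qed.

Lemma quo_lift_additive (V W : zmodType) (G : set V) (f : {additive V -> W})
  (f0 : forall x, G x -> f x = 0) : zmod_morphism (quo_lift f0).
Proof.
move=> x y; rewrite -[x]quo_piK -[y]quo_piK -raddfB !quo_lift_pi.
exact: raddfB.
Qed.

HB.instance Definition _ (V W : zmodType) (G : set V) (f : {additive V -> W})
  (f0 : forall x, G x -> f x = 0) :=
  GRing.isZmodMorphism.Build (quo G) W (quo_lift f0) (quo_lift_additive f0).

Section QuotientRing.
Variables (A : pzRingType) (G : set A).

(* As a subgroup, the two-sided ideal (G) is generated by the a * g * b. *)
Definition two_sided : set A :=
  [set x | exists a g b, G g /\ x = a * g * b].

Definition ringquo := quo two_sided.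
HB.instance Definition _ := GRing.Zmodule.on ringquo.

Definition ringquo_pi : A -> ringquo := quo_pi two_sided.
HB.instance Definition _ := GRing.Additive.on ringquo_pi.

Lemma two_sidedMl a x :
  subgroup_gen two_sided x -> subgroup_gen two_sided (a * x).
Proof.
elim=> [y [b [g [c [Gg ->]]]]||y z _ Hy _ Hz].
- by apply: sg_gen; exists (a * b), g, c; rewrite !mulrA.
- by rewrite mulr0; exact: sg_zero.
- by rewrite mulrBr; exact: sg_sub.
Qed.

Lemma two_sidedMr a x :
  subgroup_gen two_sided x -> subgroup_gen two_sided (x * a).
Proof.
elim=> [y [b [g [c [Gg ->]]]]||y z _ Hy _ Hz].
- by apply: sg_gen; exists b, g, (c * a); rewrite !mulrA.
- by rewrite mul0r; exact: sg_zero.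
- by rewrite mulrBl; exact: sg_sub.
Qed.

Definition ringquo_mul (x y : ringquo) : ringquo :=
  ringquo_pi (repr x * repr y).

Lemma ringquo_piK (x : ringquo) : ringquo_pi (repr x) = x.
Proof. exact: quo_piK. Qed.

Lemma ringquo_piM x y :
  ringquo_pi (x * y) = ringquo_mul (ringquo_pi x) (ringquo_pi y).
Proof.
rewrite /ringquo_mul; set x' := repr _; set y' := repr (ringquo_pi y).
have /quo_piP xx' : ringquo_pi x = ringquo_pi x' by rewrite ringquo_piK.
have /quo_piP yy' : ringquo_pi y = ringquo_pi y' by rewrite ringquo_piK.
apply/quo_piP.
rewrite -[x * y](subrK (x * y')) -addrA -mulrBr -mulrBl.
rewrite -[X in _ + X]opprK; apply: sg_sub; first exact: two_sidedMl.
by rewrite -sub0r; apply: sg_sub; [exact: sg_zero|exact: two_sidedMr].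
Qed.

Lemma ringquo_mulA : associative ringquo_mul.
Proof.
move=> x y z; rewrite -[x]ringquo_piK -[y]ringquo_piK -[z]ringquo_piK.
by rewrite -!ringquo_piM mulrA.
Qed.

Lemma ringquo_mul1 : left_id (ringquo_pi 1) ringquo_mul.
Proof. by move=> x; rewrite -[x]ringquo_piK -ringquo_piM mul1r. Qed.

Lemma ringquo_mulr1 : right_id (ringquo_pi 1) ringquo_mul.
Proof. by move=> x; rewrite -[x]ringquo_piK -ringquo_piM mulr1. Qed.

Lemma ringquo_mulDl : left_distributive ringquo_mul +%R.
Proof.
move=> x y z; rewrite -[x]ringquo_piK -[y]ringquo_piK -[z]ringquo_piK.
by rewrite -raddfD -!ringquo_piM -raddfD mulrDl.
Qed.

Lemma ringquo_mulDr : right_distributive ringquo_mul +%R.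
Proof.
move=> x y z; rewrite -[x]ringquo_piK -[y]ringquo_piK -[z]ringquo_piK.
by rewrite -raddfD -!ringquo_piM -raddfD mulrDr.
Qed.

HB.instance Definition _ := GRing.Zmodule_isPzRing.Build ringquo
  ringquo_mulA ringquo_mul1 ringquo_mulr1 ringquo_mulDl ringquo_mulDr.

Lemma ringquo_pi_monoid : monoid_morphism ringquo_pi.
Proof. by split=> // x y; rewrite ringquo_piM. Qed.

HB.instance Definition _ :=
  GRing.isMonoidMorphism.Build A ringquo ringquo_pi ringquo_pi_monoid.

End QuotientRing.

HB.mixin Record isLie L & GRing.Lmodule rat L := {
  bracket : L -> L -> L;
  bracket_linear_l : forall y, linear (bracket^~ y);
  bracket_linear_r : forall x, linear (bracket x);
  bracketxx : forall x, bracket x x = 0;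
  jacobi : forall x y z, bracket x (bracket y z) + bracket y (bracket z x)
                         + bracket z (bracket x y) = 0
}.

#[short(type="lieType")]
HB.structure Definition Lie := {L of GRing.Lmodule rat L & isLie L}.

Section BracketTheory.
Variable L : lieType.

Lemma bracketBl (y x x' : L) :
  bracket (x - x') y = bracket x y - bracket x' y.
Proof.
have H := bracket_linear_l y (-1) x' x.
by rewrite !scaleN1r in H; rewrite addrC H addrC.
Qed.

Lemma bracketBr (x y y' : L) :
  bracket x (y - y') = bracket x y - bracket x y'.
Proof.
have H := bracket_linear_r x (-1) y' y.
by rewrite !scaleN1r in H; rewrite addrC H addrC.
Qed.

Lemma bracket0l (y : L) : bracket 0 y = 0.
Proof. by rewrite -(subrr 0) bracketBl !subrr. Qed.

Lemma bracket0r (x : L) : bracket x 0 = 0.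
Proof. by rewrite -(subrr 0) bracketBr !subrr. Qed.

Lemma bracketZl c (x y : L) : bracket (c *: x) y = c *: bracket x y.
Proof. by have := bracket_linear_l y c x 0; rewrite !addr0 bracket0l addr0. Qed.

Lemma bracketZr c (x y : L) : bracket x (c *: y) = c *: bracket x y.
Proof. by have := bracket_linear_r x c y 0; rewrite !addr0 bracket0r addr0. Qed.

Lemma bracketDl (y x x' : L) :
  bracket (x + x') y = bracket x y + bracket x' y.
Proof. by have := bracket_linear_l y 1 x x'; rewrite !scale1r. Qed.

Lemma bracketDr (x y y' : L) :
  bracket x (y + y') = bracket x y + bracket x y'.
Proof. by have := bracket_linear_r x 1 y y'; rewrite !scale1r. Qed.

Lemma bracketC (x y : L) : bracket x y = - bracket y x.
Proof.
apply/eqP; rewrite -addr_eq0; apply/eqP.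
have := bracketxx (x + y); rewrite bracketDl !bracketDr !bracketxx.
by rewrite add0r addr0.
Qed.

End BracketTheory.

Section LowerCentralSeries.
Variable L : lieType.

Definition lie_span (G : set L) : set L :=
  subgroup_gen [set x | exists c g, G g /\ x = c *: g].

(* [lcs n] is L^(n+1), with L^1 = L. *)
Fixpoint lcs (n : nat) : set L :=
  if n is n'.+1 then
    lie_span [set z | exists x y, lcs n' y /\ z = bracket x y]
  else setT.

Lemma lcsB n x y : lcs n x -> lcs n y -> lcs n (x - y).
Proof. by case: n => // n; exact: sg_sub. Qed.

Lemma lcs0 n : lcs n 0.
Proof. by case: n => // n; exact: sg_zero. Qed.

Lemma lcsZ n c x : lcs n x -> lcs n (c *: x).
Proof.
case: n => // n; elim=> [y [d [g [Gg ->]]]||y z _ Hy _ Hz].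
- by apply: sg_gen; exists (c * d), g; rewrite scalerA.
- by rewrite scaler0; exact: sg_zero.
- by rewrite scalerBr; exact: sg_sub.
Qed.

Lemma lcs_bracket n x y : lcs n y -> lcs n.+1 (bracket x y).
Proof.
move=> Ly; apply: sg_gen; exists 1, (bracket x y); rewrite scale1r.
by split=> //; exists x, y.
Qed.

Lemma lcsS n : lcs n.+1 `<=` lcs n.
Proof.
elim: n => // n IHn x; elim=> [y [c [g [[a [b [Lb ->]]] ->]]]||y z _ Hy _ Hz].
- by apply: lcsZ; apply: lcs_bracket; exact: IHn.
- exact: lcs0.
- exact: lcsB.
Qed.

Lemma lcs_ideal n x y : lcs n y -> lcs n (bracket x y).
Proof. by move=> Ly; apply/lcsS/lcs_bracket. Qed.

End LowerCentralSeries.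

Record lie_ideal (L : lieType) := LieIdeal {
  ideal_set : set L;
  ideal0 : ideal_set 0;
  idealB : forall x y, ideal_set x -> ideal_set y -> ideal_set (x - y);
  idealZ : forall c x, ideal_set x -> ideal_set (c *: x);
  ideal_bracket : forall x y, ideal_set y -> ideal_set (bracket x y) }.

Definition lcs_lie_ideal (L : lieType) n : lie_ideal L :=
  LieIdeal (@lcs0 L n) (@lcsB L n) (@lcsZ L n) (@lcs_ideal L n).

Section QuotientLie.
Variables (L : lieType) (I : lie_ideal L).

Definition liequo := quo (ideal_set I).
HB.instance Definition _ := GRing.Zmodule.on liequo.

Definition liequo_pi : L -> liequo := quo_pi (ideal_set I).
HB.instance Definition _ := GRing.Additive.on liequo_pi.

Lemma ideal_genE x : subgroup_gen (ideal_set I) x -> ideal_set I x.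
Proof.
by elim=> // [|y z _ Iy _ Iz]; [exact: ideal0|exact: idealB].
Qed.

Lemma liequo_piP x y : liequo_pi x = liequo_pi y <-> ideal_set I (x - y).
Proof.
split=> [/quo_piP/ideal_genE //|Ixy].
by apply/quo_piP; exact: sg_gen.
Qed.

Lemma liequo_piK (x : liequo) : liequo_pi (repr x) = x.
Proof. exact: quo_piK. Qed.

Definition liequo_scale (c : rat) (x : liequo) : liequo :=
  liequo_pi (c *: repr x).

Lemma liequo_piZ c x : liequo_pi (c *: x) = liequo_scale c (liequo_pi x).
Proof.
apply/liequo_piP; rewrite -scalerBr; apply: idealZ.
by apply/liequo_piP; rewrite liequo_piK.
Qed.

Lemma liequo_scaleA a b v :
  liequo_scale a (liequo_scale b v) = liequo_scale (a * b) v.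
Proof. by rewrite -[v]liequo_piK -!liequo_piZ scalerA. Qed.

Lemma liequo_scale1 : left_id 1 liequo_scale.
Proof. by move=> v; rewrite -[v]liequo_piK -!liequo_piZ scale1r. Qed.

Lemma liequo_scaleDr : right_distributive liequo_scale +%R.
Proof.
move=> c u v; rewrite -[u]liequo_piK -[v]liequo_piK.
by rewrite -raddfD -!liequo_piZ -raddfD scalerDr.
Qed.

Lemma liequo_scaleDl v : {morph liequo_scale^~ v : a b / a + b}.
Proof.
by move=> a b; rewrite -[v]liequo_piK -!liequo_piZ -raddfD scalerDl.
Qed.

HB.instance Definition _ := GRing.Zmodule_isLmodule.Build rat liequo
  liequo_scaleA liequo_scale1 liequo_scaleDr liequo_scaleDl.

Definition liequo_bracket (x y : liequo) : liequo :=
  liequo_pi (bracket (repr x) (repr y)).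

Lemma liequo_pi_bracket x y :
  liequo_pi (bracket x y) = liequo_bracket (liequo_pi x) (liequo_pi y).
Proof.
rewrite /liequo_bracket; set x' := repr _; set y' := repr (liequo_pi y).
have /liequo_piP xx' : liequo_pi x = liequo_pi x' by rewrite liequo_piK.
have /liequo_piP yy' : liequo_pi y = liequo_pi y' by rewrite liequo_piK.
apply/liequo_piP.
rewrite -[bracket x y](subrK (bracket x y')) -addrA -bracketBr -bracketBl.
rewrite bracketC -bracketC [X in _ + X]bracketC; apply: idealB.
  exact: ideal_bracket.
exact: ideal_bracket.
Qed.

Lemma liequo_linear_l y : linear (liequo_bracket^~ y).
Proof.
move=> c u v; rewrite -[u]liequo_piK -[v]liequo_piK -[y]liequo_piK.
rewrite -[c *: liequo_pi _]liequo_piZ -raddfD -!liequo_pi_bracket.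
by rewrite bracketDl bracketZl raddfD /= liequo_piZ.
Qed.

Lemma liequo_linear_r x : linear (liequo_bracket x).
Proof.
move=> c u v; rewrite -[u]liequo_piK -[v]liequo_piK -[x]liequo_piK.
rewrite -[c *: liequo_pi _]liequo_piZ -raddfD -!liequo_pi_bracket.
by rewrite bracketDr bracketZr raddfD /= liequo_piZ.
Qed.

Lemma liequo_bracketxx x : liequo_bracket x x = 0.
Proof. by rewrite -[x]liequo_piK -liequo_pi_bracket bracketxx raddf0. Qed.

Lemma liequo_jacobi x y z :
  liequo_bracket x (liequo_bracket y z) + liequo_bracket y (liequo_bracket z x)
  + liequo_bracket z (liequo_bracket x y) = 0.
Proof.
rewrite -[x]liequo_piK -[y]liequo_piK -[z]liequo_piK -!liequo_pi_bracket.
by rewrite -!raddfD jacobi raddf0.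
Qed.

HB.instance Definition _ := isLie.Build liequo liequo_linear_l liequo_linear_r
  liequo_bracketxx liequo_jacobi.

End QuotientLie.

Record lie_tower := LieTower {
  tower_obj : nat -> lieType;
  tower_map : forall n, tower_obj n.+1 -> tower_obj n;
  tower_mapB : forall n, {morph @tower_map n : x y / x - y};
  tower_mapZ : forall n c, {morph @tower_map n : x / c *: x};
  tower_map_bracket : forall n, {morph @tower_map n : x y / bracket x y} }.

Section InverseLimit.
Variable T : lie_tower.

Record invlim := Invlim {
  coord : forall n, tower_obj T n;
  coord_trans : forall n, tower_map (coord n.+1) = coord n }.

HB.instance Definition _ := gen_eqMixin invlim.
HB.instance Definition _ := gen_choiceMixin invlim.

Lemma invlim_ext u v : (forall n, coord u n = coord v n) -> u = v.
Proof.
case: u v => u Hu [v Hv] /= uv.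
have {}uv : u = v by apply: functional_extensionality_dep.
by subst v; congr Invlim; exact: Prop_irrelevance.
Qed.

Lemma invlim0_subproof n :
  tower_map (0 : tower_obj T n.+1) = 0.
Proof. by have := @tower_mapB T n 0 0; rewrite !subrr. Qed.

Lemma invlimN_subproof u n :
  tower_map (- coord u n.+1) = - coord u n.
Proof.
have := tower_mapB 0 (coord u n.+1);
  by rewrite !sub0r invlim0_subproof coord_trans sub0r.
Qed.

Lemma invlimD_subproof u v n :
  tower_map (coord u n.+1 + coord v n.+1) = coord u n + coord v n.
Proof.
by rewrite -[coord v n.+1]opprK tower_mapB invlimN_subproof
   coord_trans opprK.
Qed.

Lemma invlimZ_subproof c u n :
  tower_map (c *: coord u n.+1) = c *: coord u n.
Proof. by rewrite tower_mapZ coord_trans. Qed.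

Lemma invlim_bracket_subproof u v n :
  tower_map (bracket (coord u n.+1) (coord v n.+1))
  = bracket (coord u n) (coord v n).
Proof. by rewrite tower_map_bracket !coord_trans. Qed.

Definition invlim0 := Invlim invlim0_subproof.
Definition invlimN u := Invlim (invlimN_subproof u).
Definition invlimD u v := Invlim (invlimD_subproof u v).
Definition invlimZ c u := Invlim (invlimZ_subproof c u).
Definition invlim_bracket u v :=
  Invlim (invlim_bracket_subproof u v).

Lemma invlimDA : associative invlimD.
Proof. by move=> u v w; apply: invlim_ext => n; exact: addrA. Qed.

Lemma invlimDC : commutative invlimD.
Proof. by move=> u v; apply: invlim_ext => n; exact: addrC. Qed.

Lemma invlim0D : left_id invlim0 invlimD.
Proof. by move=> u; apply: invlim_ext => n; exact: add0r. Qed.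

Lemma invlimND : left_inverse invlim0 invlimN invlimD.
Proof. by move=> u; apply: invlim_ext => n; exact: addNr. Qed.

HB.instance Definition _ := GRing.isZmodule.Build invlim
  invlimDA invlimDC invlim0D invlimND.

Lemma invlimZA a b u :
  invlimZ a (invlimZ b u) = invlimZ (a * b) u.
Proof. by apply: invlim_ext => n; exact: scalerA. Qed.

Lemma invlimZ1 : left_id 1 invlimZ.
Proof. by move=> u; apply: invlim_ext => n; exact: scale1r. Qed.

Lemma invlimZDr : right_distributive invlimZ +%R.
Proof. by move=> c u v; apply: invlim_ext => n; exact: scalerDr. Qed.

Lemma invlimZDl u : {morph invlimZ^~ u : a b / a + b}.
Proof. by move=> a b; apply: invlim_ext => n; exact: scalerDl. Qed.

HB.instance Definition _ := GRing.Zmodule_isLmodule.Build rat invlim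
  invlimZA invlimZ1 invlimZDr invlimZDl.

Lemma invlim_linear_l v : linear (invlim_bracket^~ v).
Proof. by move=> c u w; apply: invlim_ext => n; exact: bracket_linear_l. Qed.

Lemma invlim_linear_r u : linear (invlim_bracket u).
Proof. by move=> c v w; apply: invlim_ext => n; exact: bracket_linear_r. Qed.

Lemma invlim_bracketxx u : invlim_bracket u u = 0.
Proof. by apply: invlim_ext => n; exact: bracketxx. Qed.

Lemma invlim_jacobi u v w :
  invlim_bracket u (invlim_bracket v w)
  + invlim_bracket v (invlim_bracket w u)
  + invlim_bracket w (invlim_bracket u v) = 0.
Proof. by apply: invlim_ext => n; exact: jacobi. Qed.

HB.instance Definition _ := isLie.Build invlim
  invlim_linear_l invlim_linear_r invlim_bracketxx
  invlim_jacobi.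

End InverseLimit.

Section Completion.
Variable L : lieType.

Definition lcsquo n : lieType := liequo (lcs_lie_ideal L n).

Lemma lcsquo_trans_subproof n (x : L) :
  ideal_set (lcs_lie_ideal L n.+1) x -> liequo_pi (lcs_lie_ideal L n) x = 0.
Proof.
move=> /lcsS Lx; rewrite -(raddf0 (liequo_pi (lcs_lie_ideal L n))).
by apply/liequo_piP; rewrite subr0.
Qed.

Definition lcsquo_trans n : lcsquo n.+1 -> lcsquo n :=
  quo_lift (@lcsquo_trans_subproof n).

Lemma lcsquo_trans_pi n x :
  lcsquo_trans (liequo_pi (lcs_lie_ideal L n.+1) x)
  = liequo_pi (lcs_lie_ideal L n) x.
Proof. exact: quo_lift_pi. Qed.

Lemma lcsquo_transB n : {morph @lcsquo_trans n : x y / x - y}.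
Proof. exact: quo_lift_additive. Qed.

Lemma lcsquo_transZ n c : {morph @lcsquo_trans n : x / c *: x}.
Proof.
move=> x; rewrite -[x]liequo_piK.
rewrite -[c *: liequo_pi _ _]liequo_piZ !lcsquo_trans_pi.
exact: liequo_piZ.
Qed.

Lemma lcsquo_trans_bracket n : {morph @lcsquo_trans n : x y / bracket x y}.
Proof.
move=> x y; rewrite -[x]liequo_piK -[y]liequo_piK.
rewrite -[bracket _ _ in LHS]liequo_pi_bracket !lcsquo_trans_pi.
exact: liequo_pi_bracket.
Qed.

Definition lcs_tower := LieTower lcsquo_transB lcsquo_transZ lcsquo_trans_bracket.

(* The limit of L/L^1 <- L/L^2 <- L/L^3 <- ... *)
Definition completion : lieType := invlim lcs_tower.

End Completion.

(* [(p, a)] stands for p + a t. *)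
Definition lamplighter := ({poly rat} * rat^o)%type.
HB.instance Definition _ := GRing.Lmodule.on lamplighter.

(* From [p, t] = x p: [p + a t, q + b t] = b x p - a x q. *)
Definition lamplighter_bracket (u v : lamplighter) : lamplighter :=
  (v.2 *: ('X * u.1) - u.2 *: ('X * v.1), 0).

Lemma lamplighter_linear_l v : linear (lamplighter_bracket^~ v).
Proof.
move=> c [p a] [q b]; case: v => [r d]; congr pair => /=; last first.
  by rewrite /= scaler0 addr0.
rewrite -!mul_polyC polyCD polyCM; ring.
Qed.

Lemma lamplighter_bracketxx u : lamplighter_bracket u u = 0.
Proof. by rewrite /lamplighter_bracket subrr. Qed.

Lemma lamplighter_bracketC u v :
  lamplighter_bracket u v = - lamplighter_bracket v u.
Proof. by congr pair => /=; rewrite ?opprB ?oppr0. Qed.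

Lemma lamplighter_linear_r u : linear (lamplighter_bracket u).
Proof.
move=> c v w; rewrite lamplighter_bracketC lamplighter_linear_l.
by rewrite opprD -scalerN -!lamplighter_bracketC.
Qed.

Lemma lamplighter_jacobi u v w :
  lamplighter_bracket u (lamplighter_bracket v w)
  + lamplighter_bracket v (lamplighter_bracket w u)
  + lamplighter_bracket w (lamplighter_bracket u v) = 0.
Proof.
case: u v w => [p a] [q b] [r c]; congr pair => /=.
rewrite -!mul_polyC; ring.
Qed.

HB.instance Definition _ := isLie.Build lamplighter
  lamplighter_linear_l lamplighter_linear_r lamplighter_bracketxx
  lamplighter_jacobi.

Section UniversalEnvelopingAlgebra.
Variable E : lieType.

(* The free associative algebra on the set E, which becomes T(E) once the
   linearity relations below are imposed. *)
Definition free_alg := {malg rat[{fmonom E}]}.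
HB.instance Definition _ := GRing.Lalgebra.on free_alg.

Definition free_gen (x : E) : free_alg := << fmu x >>.

Inductive ue_rel : set free_alg :=
| ue_add x y : ue_rel (free_gen (x + y) - (free_gen x + free_gen y))
| ue_scale c x : ue_rel (free_gen (c *: x) - c *: free_gen x)
| ue_bracket x y :
    ue_rel (free_gen x * free_gen y - free_gen y * free_gen x
            - free_gen (bracket x y)).

Definition UE := ringquo ue_rel.
HB.instance Definition _ := GRing.PzRing.on UE.

Definition ue_pi : free_alg -> UE := ringquo_pi ue_rel.
HB.instance Definition _ := GRing.RMorphism.on ue_pi.

Definition ue_gen (x : E) : UE := ue_pi (free_gen x).

Definition free_aug : free_alg -> rat := mcoeff (mone : {fmonom E}).
HB.instance Definition _ := GRing.RMorphism.on free_aug.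

Lemma free_augB u v : free_aug (u - v) = free_aug u - free_aug v.
Proof. exact: raddfB. Qed.

Lemma free_augD u v : free_aug (u + v) = free_aug u + free_aug v.
Proof. exact: raddfD. Qed.

Lemma free_augM u v : free_aug (u * v) = free_aug u * free_aug v.
Proof. exact: rmorphM. Qed.

Lemma free_augZ c u : free_aug (c *: u) = c * free_aug u.
Proof. exact: mcoeffZ. Qed.

Lemma free_aug_gen x : free_aug (free_gen x) = 0.
Proof.
rewrite /free_aug /= /free_gen mcoeffU; case: eqP => // /(congr1 (@fdeg _)).
by rewrite fdegU fdeg1.
Qed.

Lemma free_aug_rel x : ue_rel x -> free_aug x = 0.
Proof.
case=> [y z|c y|y z].
- by rewrite free_augB free_augD !free_aug_gen.
- by rewrite free_augB free_augZ !free_aug_gen mulr0.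
- have aug0B u v : free_aug u = 0 -> free_aug v = 0 -> free_aug (u - v) = 0.
    by rewrite free_augB => -> ->.
  have aug0M u v : free_aug (free_gen u * free_gen v) = 0.
    by rewrite free_augM free_aug_gen mul0r.
  exact: (aug0B _ _ (aug0B _ _ (aug0M _ _) (aug0M _ _)) (free_aug_gen _)).
Qed.

Lemma free_aug_ideal x : two_sided ue_rel x -> free_aug x = 0.
Proof.
by move=> [a [g [b [/free_aug_rel g0 ->]]]]; rewrite !free_augM g0 mulr0 mul0r.
Qed.

Lemma ue_nontrivial : (1 : UE) != 0.
Proof.
apply/eqP => H; have /quo_piP : quo_pi (two_sided ue_rel) 1 = quo_pi _ 0.
  by rewrite raddf0.
rewrite subr0 => /(subgroup_gen_lift free_aug_ideal).
by rewrite [LHS]rmorph1 => /eqP; rewrite oner_eq0.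
Qed.

HB.instance Definition _ := GRing.PzSemiRing_isNonZero.Build UE ue_nontrivial.

(* The augmentation, sending each element of E to 0. *)
Definition ue_aug : UE -> rat := quo_lift free_aug_ideal.
HB.instance Definition _ := GRing.Additive.on ue_aug.

Lemma ue_aug_pi x : ue_aug (ue_pi x) = free_aug x.
Proof. exact: quo_lift_pi. Qed.

Lemma ue_aug_monoid : monoid_morphism ue_aug.
Proof.
split=> [|x y]; first by rewrite -(rmorph1 ue_pi) ue_aug_pi rmorph1.
rewrite -[x]ringquo_piK -[y]ringquo_piK.
by rewrite -(rmorphM ue_pi) !ue_aug_pi rmorphM.
Qed.

HB.instance Definition _ :=
  GRing.isMonoidMorphism.Build UE rat ue_aug ue_aug_monoid.

(* The trivial left module, and the trivial right module as a left module
   over the opposite ring. *)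
Definition trivl (F : lieType) := rat.
HB.instance Definition _ F := GRing.Zmodule.on (trivl F).
Definition trivr (F : lieType) := rat.
HB.instance Definition _ F := GRing.Zmodule.on (trivr F).

Definition trivl_scale (a : UE) (q : trivl E) : trivl E := ue_aug a * q.
Definition trivr_scale (a : UE^c) (q : trivr E) : trivr E := ue_aug a * q.

Lemma trivl_scaleA a b q :
  trivl_scale a (trivl_scale b q) = trivl_scale (a * b) q.
Proof. by rewrite /trivl_scale rmorphM mulrA. Qed.

Lemma trivl_scale1 : left_id 1 trivl_scale.
Proof. by move=> q; rewrite /trivl_scale rmorph1 mul1r. Qed.

Lemma trivl_scaleDr : right_distributive trivl_scale +%R.
Proof. by move=> a q r; rewrite /trivl_scale mulrDr. Qed.

Lemma trivl_scaleDl q : {morph trivl_scale^~ q : a b / a + b}.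
Proof. by move=> a b; rewrite /trivl_scale raddfD mulrDl. Qed.

HB.instance Definition _ := GRing.Zmodule_isLmodule.Build UE (trivl E)
  trivl_scaleA trivl_scale1 trivl_scaleDr trivl_scaleDl.

Lemma trivr_scaleA (a b : UE^c) q :
  trivr_scale a (trivr_scale b q) = trivr_scale (a * b) q.
Proof.
rewrite /trivr_scale mulrA; congr (_ * q).
by rewrite mulrC -(rmorphM ue_aug).
Qed.

Lemma trivr_scale1 : left_id (1 : UE^c) trivr_scale.
Proof. exact: trivl_scale1. Qed.

Lemma trivr_scaleDr : right_distributive trivr_scale +%R.
Proof. exact: trivl_scaleDr. Qed.

Lemma trivr_scaleDl q : {morph trivr_scale^~ q : a b / a + b}.
Proof. exact: trivl_scaleDl. Qed.

HB.instance Definition _ := GRing.Zmodule_isLmodule.Build UE^c (trivr E)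
  trivr_scaleA trivr_scale1 trivr_scaleDr trivr_scaleDl.

End UniversalEnvelopingAlgebra.

Section FreeModule.
Variables (R : nzRingType) (X : choiceType) (N : lmodType R) (g : X -> N).

Definition free_lift (u : {malg R[X]}) : N := \sum_(x <- msupp u) u@_x *: g x.

Lemma free_liftEw (d : {fset X}) (u : {malg R[X]}) :
  (msupp u `<=` d)%fset -> free_lift u = \sum_(x <- d) u@_x *: g x.
Proof.
move=> le; rewrite [LHS](big_fset_incl _ le) => //= x xd /mcoeff_outdom ->.
by rewrite scale0r.
Qed.

Lemma free_lift_linear : linear free_lift.
Proof.
move=> a u v; pose d := (msupp (a *: u + v) `|` msupp u `|` msupp v)%fset.
have hl : (msupp (a *: u + v) `<=` d)%fset by rewrite /d -fsetUA fsubsetUl.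
have hu : (msupp u `<=` d)%fset by rewrite /d fsetUAC fsubsetUr.
have hv : (msupp v `<=` d)%fset by rewrite /d fsubsetUr.
rewrite (free_liftEw hl) (free_liftEw hu) (free_liftEw hv) scaler_sumr.
rewrite -big_split; apply: eq_bigr => x _ /=.
by rewrite mcoeffD mcoeffZ scalerDl scalerA.
Qed.

HB.instance Definition _ :=
  GRing.isLinear.Build R {malg R[X]} N _ free_lift free_lift_linear.

Lemma free_lift_gen x : free_lift << x >> = g x.
Proof.
by rewrite (free_liftEw msuppU_le) big_seq_fset1 mcoeffUU scale1r.
Qed.

End FreeModule.

Definition projective (R : nzRingType) (P : lmodType R) : Prop :=
  forall (A B : lmodType R) (f : {linear A -> B}) (g : {linear P -> B}),
    (forall b, exists a, f a = b) ->
    exists h : {linear P -> A}, forall x, f (h x) = g x.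

Lemma free_projective (R : nzRingType) (X : choiceType) :
  projective {malg R[X]}.
Proof.
move=> A B f g f_surj.
have [x|s fs] := @choice _ _ (fun x a => f a = g << x >>).
  exact: f_surj.
exists (free_lift s) => u.
rewrite [in RHS](monalgE u) linear_sum /= linear_sum; apply: eq_bigr => x _.
rewrite linearZ /= fs -linearZ /=; congr (g _).
by apply/malgP => k; rewrite mcoeffZ !mcoeffU mulrnAr mulr1.
Qed.

Record resolution (R : nzRingType) (N : lmodType R) := Resolution {
  res_obj : nat -> lmodType R;
  res_diff : forall n, {linear res_obj n.+1 -> res_obj n};
  res_aug : {linear res_obj 0%N -> N};
  res_projective : forall n, projective (res_obj n);
  res_surj : forall x, exists y, res_aug y = x;
  res_exact0 : forall y, res_aug y = 0 <-> exists z, res_diff 0 z = y;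
  res_exactS : forall n y,
    res_diff n y = 0 <-> exists z, res_diff n.+1 z = y }.

Section FreeResolution.
Variables (R : nzRingType) (N : lmodType R).

Record arrow := Arrow {
  arrow_src : lmodType R;
  arrow_tgt : lmodType R;
  arrow_fun : {linear arrow_src -> arrow_tgt} }.

Definition kernel (a : arrow) := {x : arrow_src a | arrow_fun a x == 0}.
HB.instance Definition _ a := Choice.on (kernel a).

(* Start with the free module on the set N, and repeatedly cover the kernel
   of the last map by the free module on its underlying set. *)
Fixpoint free_stage (n : nat) : arrow :=
  if n is n'.+1 then
    let a := free_stage n' in
    @Arrow {malg R[kernel a]} (arrow_src a)
      (@free_lift R (kernel a) (arrow_src a) val)
  else @Arrow {malg R[N]} N (@free_lift R N N id).

Definition free_res_obj n := arrow_src (free_stage n).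
Definition free_res_diff n : {linear free_res_obj n.+1 -> free_res_obj n} :=
  arrow_fun (free_stage n.+1).
Definition free_res_aug : {linear free_res_obj 0%N -> N} :=
  arrow_fun (free_stage 0).

Lemma free_res_projective n : projective (free_res_obj n).
Proof. by case: n => [|n]; exact: free_projective. Qed.

Lemma free_res_surj x : exists y, free_res_aug y = x.
Proof. by exists << x >>; rewrite [LHS]free_lift_gen. Qed.

Lemma kernel_cover_exact (a : arrow) y : arrow_fun a y = 0 <->
  exists z, @free_lift R (kernel a) (arrow_src a) val z = y.
Proof.
split=> [/eqP y0|[z <-]].
  by exists << (exist _ y y0 : kernel a) >>; rewrite free_lift_gen.
rewrite /free_lift linear_sum; apply: big1 => x _.
by rewrite linearZ /= (eqP (valP x)) scaler0.
Qed.

Lemma free_stage_exact n y : arrow_fun (free_stage n) y = 0 <->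
  exists z, arrow_fun (free_stage n.+1) z = y.
Proof. exact: kernel_cover_exact. Qed.

Definition free_resolution : resolution N :=
  @Resolution R N free_res_obj free_res_diff free_res_aug free_res_projective
    free_res_surj (@free_stage_exact 0) (fun n => @free_stage_exact n.+1).

End FreeResolution.

Section TensorProduct.
Variables (R : nzRingType) (M : lmodType R^c).

Section Object.
Variable N : lmodType R.

Definition tens_free := {malg int[(M * N)%type]}.
HB.instance Definition _ := GRing.Zmodule.on tens_free.

Definition tens_gen (m : M) (n : N) : tens_free := << (m, n) >>.

(* [a *: m] with [a : R^c] is the right multiplication m . a. *)
Inductive tens_rel : set tens_free :=
| tens_addl m m' n :
    tens_rel (tens_gen (m + m') n - (tens_gen m n + tens_gen m' n))
| tens_addr m n n' :
    tens_rel (tens_gen m (n + n') - (tens_gen m n + tens_gen m n'))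
| tens_bal (a : R) m n :
    tens_rel (tens_gen ((a : R^c) *: m) n - tens_gen m (a *: n)).

Definition tens := quo tens_rel.
HB.instance Definition _ := GRing.Zmodule.on tens.

Definition tens_pure (m : M) (n : N) : tens := quo_pi tens_rel (tens_gen m n).

Lemma tens_pureDl m m' n :
  tens_pure (m + m') n = tens_pure m n + tens_pure m' n.
Proof.
rewrite /tens_pure -raddfD; apply/quo_piP; apply: sg_gen.
exact: tens_addl.
Qed.

Lemma tens_pureDr m n n' :
  tens_pure m (n + n') = tens_pure m n + tens_pure m n'.
Proof.
rewrite /tens_pure -raddfD; apply/quo_piP; apply: sg_gen.
exact: tens_addr.
Qed.

Lemma tens_pure_bal (a : R) m n :
  tens_pure ((a : R^c) *: m) n = tens_pure m (a *: n).
Proof. by apply/quo_piP; apply: sg_gen; exact: tens_bal. Qed.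

End Object.

Section Map.
Variables (N N' : lmodType R) (f : {linear N -> N'}).

Definition tens_free_map (u : tens_free N) : tens N' :=
  \sum_(p <- msupp u) tens_pure p.1 (f p.2) *~ u@_p.

Lemma tens_free_mapEw (d : {fset (M * N)%type}) (u : tens_free N) :
  (msupp u `<=` d)%fset ->
  tens_free_map u = \sum_(p <- d) tens_pure p.1 (f p.2) *~ u@_p.
Proof.
move=> le; rewrite [LHS](big_fset_incl _ le) => //= x xd /mcoeff_outdom ->.
by rewrite mulr0z.
Qed.

Lemma tens_free_map_additive : zmod_morphism tens_free_map.
Proof.
move=> u v; pose d := (msupp (u - v) `|` msupp u `|` msupp v)%fset.
have hl : (msupp (u - v) `<=` d)%fset by rewrite /d -fsetUA fsubsetUl.
have hu : (msupp u `<=` d)%fset by rewrite /d fsetUAC fsubsetUr.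
have hv : (msupp v `<=` d)%fset by rewrite /d fsubsetUr.
rewrite (tens_free_mapEw hl) (tens_free_mapEw hu) (tens_free_mapEw hv).
by rewrite -sumrB; apply: eq_bigr => x _; rewrite mcoeffB mulrzBr.
Qed.

HB.instance Definition _ := GRing.isZmodMorphism.Build (tens_free N) (tens N')
  tens_free_map tens_free_map_additive.

Lemma tens_free_map_gen m n :
  tens_free_map (tens_gen m n) = tens_pure m (f n).
Proof. by rewrite (tens_free_mapEw msuppU_le) big_seq_fset1 mcoeffUU. Qed.

Lemma tens_free_mapB u v :
  tens_free_map (u - v) = tens_free_map u - tens_free_map v.
Proof. exact: tens_free_map_additive. Qed.

Lemma tens_free_mapD u v :
  tens_free_map (u + v) = tens_free_map u + tens_free_map v.
Proof. exact: (raddfD tens_free_map). Qed.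

Lemma tens_free_map_rel u : tens_rel u -> tens_free_map u = 0.
Proof.
case=> [m m' n|m n n'|a m n]; rewrite tens_free_mapB ?tens_free_mapD;
  rewrite !tens_free_map_gen; apply/eqP; rewrite subr_eq0; apply/eqP.
- exact: tens_pureDl.
- by rewrite linearD tens_pureDr.
- by rewrite linearZ tens_pure_bal.
Qed.

Definition tens_map : tens N -> tens N' := quo_lift tens_free_map_rel.
HB.instance Definition _ := GRing.Additive.on tens_map.

Lemma tens_map_pure m n : tens_map (tens_pure m n) = tens_pure m (f n).
Proof. by rewrite [LHS]quo_lift_pi; exact: tens_free_map_gen. Qed.

End Map.
End TensorProduct.

(* H_n = Z_n / B_n, as a subgroup of C_n / B_n; in degree 0 every element is
   a cycle. *)
Section Homology.
Variables (C : nat -> zmodType) (d : forall n, {additive C n.+1 -> C n}).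

Definition cycles (n : nat) : set (C n) :=
  match n with 0%N => setT | n'.+1 => [set z | d n' z = 0] end.

Definition homology (n : nat) : set (quo (range (d n))) :=
  quo_pi (range (d n)) @` @cycles n.

End Homology.

Section TorExt.
Variables (R : nzRingType) (N : lmodType R).

Definition Tor_of (M : lmodType R^c) (P : resolution N) (n : nat) :=
  @homology (fun k => tens M (res_obj P k))
    (fun k => @tens_map R M _ _ (res_diff P k)) n.

Definition Tor (M : lmodType R^c) (n : nat) :=
  @Tor_of M (free_resolution N) n.

(* Hom_R(P_n, M) is the set of R-linear functions in the group of all
   functions P_n -> M, and Ext^n is Z^n / B^n inside that group modulo B^n. *)
Definition cocycles (P : resolution N) (M : lmodType R) (n : nat) :
    set (res_obj P n -> M) :=
  [set f | linear f /\ forall x, f (res_diff P n x) = 0].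

Definition coboundaries (P : resolution N) (M : lmodType R) (n : nat) :
    set (res_obj P n -> M) :=
  match n with
  | 0%N => [set 0]
  | n'.+1 => [set f | exists g : {linear res_obj P n' -> M},
                forall x, f x = g (res_diff P n' x)]
  end.

Definition Ext_of (P : resolution N) (M : lmodType R) (n : nat) :
    set (quo (@coboundaries P M n)) :=
  quo_pi (@coboundaries P M n) @` @cocycles P M n.

Definition Ext (M : lmodType R) (n : nat) :=
  @Ext_of (free_resolution N) M n.

End TorExt.

Definition lie_homology (E : lieType) (q : nat) :=
  @Tor (UE E) (trivl E) (trivr E) q.
Arguments lie_homology E q : clear implicits.

(* The least upper bound is taken in the integers extended by -oo and +oo. *)
Definition cohomological_dimension (E : lieType) : \bar int :=
  supremum -oo%E
    [set (q%:Z)%:E | q in [set q : nat |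
       exists M : lmodType (UE E), ~ @Ext (UE E) (trivl E) M q `<=` [set 0]]].

(* Main.v *)
From HB Require Import structures.
Require Import Defs.
From mathcomp Require Import all_boot all_order all_algebra.
From mathcomp Require Import finmap monalg ring zify qpoly.
From mathcomp Require Import boolp classical_sets functions cardinality.
From mathcomp Require Import constructive_ereal.

(* Write A = Q[[x]] for the abelian ideal of the completion E. A rational c
   gives a 1-cocycle f |-> f(cy), t |-> 0 of E with values in R =
   Q[y]/(y^(N+1)), where A acts by zero and t acts by -cy. For c_0, ...,
   c_(q-1) with sum zero, the q extensions of twisted copies of R that these
   cocycles define can be spliced: the last coefficient module is trivial
   again. Lifting the augmentation of a resolution P through this exact
   sequence gives a cocycle on P_q, and on the Koszul cycle of f_0, ...,
   f_(q-1) in A it takes the value det(f_i(c_k y)). For f_i = x^i (i < q-1)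
   and f_(q-1) = f arbitrary, a coefficient of this determinant is a
   coefficient of f times a generalized Vandermonde determinant, which is
   nonzero at least once in every q consecutive degrees. So the classes
   separate uncountably many series f; and since coboundaries with trivial
   coefficients vanish on Koszul cycles, Ext^q <> 0 as well. *)

Set Implicit Arguments.
Unset Strict Implicit.
Unset Printing Implicit Defensive.

Import Order.TTheory GRing.Theory Num.Theory.
Local Open Scope ring_scope.
Local Open Scope classical_set_scope.

(** * Modules over the enveloping algebra from matrix representations *)

Section Representations.
Variables (E : lieType) (R : comAlgType rat).

Record lie_rep (n : nat) := LieRep {
  rep_fun :> E -> 'M[R]_n.+1;
  rep_addP : {morph rep_fun : x y / x + y};
  rep_scaleP : forall c x, rep_fun (c *: x) = c%:A *: rep_fun x;
  rep_bracketP : forall x y,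
    rep_fun (bracket x y) = rep_fun x * rep_fun y - rep_fun y * rep_fun x }.

Section UERep.
Variables (n : nat) (rho : lie_rep n).

Definition word_rep (m : {fmonom E}) : 'M[R]_n.+1 := \prod_(x <- (m : seq E)) rho x.

Lemma word_rep_morph : mmorphism word_rep.
Proof.
split=> [x y|]; first by rewrite /word_rep fmM big_cat.
by rewrite /word_rep fm1 big_nil.
Qed.

HB.instance Definition _ := isMultiplicative.Build _ _ word_rep word_rep_morph.

Definition scalar_rep : rat -> 'M[R]_n.+1 := @scalar_mx R n.+1 \o in_alg R.
HB.instance Definition _ := GRing.RMorphism.on scalar_rep.

Definition free_rep : free_alg E -> 'M[R]_n.+1 := mmap scalar_rep word_rep.
HB.instance Definition _ := GRing.Additive.on free_rep.

Lemma free_rep_multiplicative : monoid_morphism free_rep.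
Proof.
suff [fM f1] : multiplicative free_rep by split.
by apply: commr_mmap_is_multiplicative => g m m'; exact/esym/scalar_mxC.
Qed.
HB.instance Definition _ :=
  GRing.isMonoidMorphism.Build _ _ free_rep free_rep_multiplicative.

Lemma free_rep_gen x : free_rep (free_gen x) = rho x.
Proof.
rewrite /free_rep mmapU /= rmorph1 mul1r /word_rep.
by rewrite fmU big_seq1.
Qed.

Lemma free_repZ c u : free_rep (c *: u) = c%:A *: free_rep u.
Proof. by rewrite /free_rep mmapZ /scalar_rep /= -mul_scalar_mx. Qed.

Lemma free_repD u v : free_rep (u + v) = free_rep u + free_rep v.
Proof. exact: raddfD. Qed.

Lemma free_repB u v : free_rep (u - v) = free_rep u - free_rep v.
Proof. exact: raddfB. Qed.

Lemma free_repM u v : free_rep (u * v) = free_rep u * free_rep v.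
Proof. exact: rmorphM. Qed.

Lemma free_rep_rel u : two_sided (@ue_rel E) u -> free_rep u = 0.
Proof.
move=> [a [g [b [rel_g ->]]]]; rewrite !free_repM.
suff -> : free_rep g = 0 by rewrite mulr0 mul0r.
case: rel_g => [x y|c x|x y].
- by rewrite free_repB free_repD !free_rep_gen rep_addP subrr.
- by rewrite free_repB free_repZ !free_rep_gen rep_scaleP subrr.
- apply: etrans (free_repB _ _) _; rewrite free_rep_gen rep_bracketP.
  apply/eqP; rewrite subr_eq0; apply/eqP; apply: etrans (free_repB _ _) _.
  by congr (_ - _); rewrite free_repM !free_rep_gen.
Qed.

Definition ue_rep : UE E -> 'M[R]_n.+1 := quo_lift free_rep_rel.
HB.instance Definition _ := GRing.Additive.on ue_rep.

Lemma ue_rep_pi u : ue_rep (ue_pi u) = free_rep u.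
Proof. exact: quo_lift_pi. Qed.

Lemma ue_rep_monoid : monoid_morphism ue_rep.
Proof.
split=> [|x y]; first by rewrite -(rmorph1 (@ue_pi E)) ue_rep_pi rmorph1.
rewrite -[x]ringquo_piK -[y]ringquo_piK.
by rewrite -(rmorphM (@ue_pi E)) !ue_rep_pi rmorphM.
Qed.
HB.instance Definition _ :=
  GRing.isMonoidMorphism.Build _ _ ue_rep ue_rep_monoid.

Lemma ue_rep_gen x : ue_rep (ue_gen x) = rho x.
Proof. by rewrite ue_rep_pi free_rep_gen. Qed.

End UERep.

(** The alias is indexed by [rho] so that one column space can carry a different [UE E]-action for
    each representation. *)
Definition rep_mod n (rho : lie_rep n) := 'cV[R]_n.+1.
HB.instance Definition _ n (rho : lie_rep n) := GRing.Zmodule.on (rep_mod rho).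

Section RepModule.
Variables (n : nat) (rho : lie_rep n).

Definition rep_scale (a : UE E) (v : rep_mod rho) : rep_mod rho :=
  ue_rep rho a *m v.

Lemma rep_scaleA a b v : rep_scale a (rep_scale b v) = rep_scale (a * b) v.
Proof. by rewrite /rep_scale rmorphM mulmxA. Qed.

Lemma rep_scale1 : left_id 1 rep_scale.
Proof. by move=> v; rewrite /rep_scale rmorph1 mul1mx. Qed.

Lemma rep_scaleDr : right_distributive rep_scale +%R.
Proof. by move=> a u v; exact: mulmxDr. Qed.

Lemma rep_scaleDl v : {morph rep_scale^~ v : a b / a + b}.
Proof. by move=> a b; rewrite /rep_scale raddfD mulmxDl. Qed.

HB.instance Definition _ := GRing.Zmodule_isLmodule.Build (UE E) (rep_mod rho)
  rep_scaleA rep_scale1 rep_scaleDr rep_scaleDl.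

Lemma rep_mod_gen x (v : rep_mod rho) : ue_gen x *: v = rho x *m v.
Proof. by rewrite -ue_rep_gen. Qed.

End RepModule.

Section Intertwiners.
Variables (m n : nat) (rho : lie_rep m) (sigma : lie_rep n).
Variable P : 'M[R]_(n.+1, m.+1).

Definition intertwiner of (forall x, P *m rho x = sigma x *m P) :=
  fun v : rep_mod rho => (P *m v : rep_mod sigma).

Hypothesis P_rho : forall x, P *m rho x = sigma x *m P.

(** On a word, [P] moves past one letter at a time; the coefficients are scalar matrices and commute
    with it as well. *)
Lemma intertwine_ue a : P *m ue_rep rho a = ue_rep sigma a *m P.
Proof.
rewrite -[a]ringquo_piK !ue_rep_pi /free_rep !mmapE mulmx_sumr mulmx_suml.
apply: eq_bigr => w _; rewrite /scalar_rep /=.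
rewrite -!mulmxE mulmxA scalar_mxC -!mulmxA; congr (_ *m _).
rewrite /word_rep; elim: (w : seq E) => [|x s IHs].
  by rewrite !big_nil mulmx1 mul1mx.
by rewrite !big_cons -!mulmxE mulmxA P_rho -mulmxA IHs mulmxA.
Qed.

Lemma intertwiner_linear : linear (intertwiner P_rho).
Proof.
move=> a u v; rewrite /intertwiner mulmxDr; congr (_ + _).
by rewrite [in LHS]/GRing.scale /= /rep_scale mulmxA intertwine_ue -mulmxA.
Qed.

HB.instance Definition _ := GRing.isLinear.Build (UE E) (rep_mod rho)
  (rep_mod sigma) _ (intertwiner P_rho) intertwiner_linear.

End Intertwiners.
End Representations.

(** * Connecting maps on cochains of a projective resolution *)

Section Lifting.
Variables (R : nzRingType) (N : lmodType R) (P : resolution N).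

Lemma res_diff_diff n x : res_diff P n (res_diff P n.+1 x) = 0.
Proof. by apply/res_exactS; exists x. Qed.

Lemma res_aug_diff x : res_aug P (res_diff P 0 x) = 0.
Proof. by apply/res_exact0; exists x. Qed.

(** This is the connecting map Ext^n(C) -> Ext^(n+1)(A) on cochains: projectivity lifts [g] to [G],
    and [G] after the differential lands in ker p = im i. The lift [G] is kept in the conclusion
    because the values of [g'] are computed from it. *)
Lemma lift_extension (A B C : lmodType R) (i : {linear A -> B})
    (p : {linear B -> C}) (n : nat) (g : {linear res_obj P n -> C}) :
  injective i -> (forall c, exists b, p b = c) ->
  (forall b, p b = 0 -> exists a, i a = b) ->
  (forall x, g (res_diff P n x) = 0) ->
  exists (G : {linear res_obj P n -> B}) (g' : {linear res_obj P n.+1 -> A}),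
    [/\ forall x, p (G x) = g x, forall x, i (g' x) = G (res_diff P n x)
      & forall x, g' (res_diff P n.+1 x) = 0].
Proof.
move=> i_inj p_surj exact_p gd0.
have [G pG] := @res_projective _ _ P n _ _ p g p_surj.
have [x|h hP] := @choice _ _ (fun x a => i a = G (res_diff P n x)).
  by apply: exact_p; rewrite pG; exact: gd0.
have h_lin : linear h.
  by move=> a u v; apply: i_inj; rewrite hP !linearP /= !hP.
pose hL : {linear res_obj P n.+1 -> A} :=
  HB.pack h (GRing.isLinear.Build _ _ _ _ h h_lin).
exists G, hL; split => //= x.
by apply: i_inj; rewrite hP res_diff_diff !linear0.
Qed.

End Lifting.

(** * Koszul chains in an arbitrary projective resolution *)

Section Koszul.

(** The pairs (i, k) and (k+1, i) with i <= k exhaust the index set. The induction cancels the new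
    column n against the new row n+1. *)
Lemma alternating_double_sum (V : zmodType) (F : nat -> nat -> V) n :
  (forall i k, (i <= k)%N -> F k.+1 i = - F i k) ->
  \sum_(i < n.+1) \sum_(k < n) F i k = 0.
Proof.
move=> F_alt; elim: n => [|n IHn]; first by rewrite big_ord1 big_ord0.
rewrite big_ord_recr /=; under eq_bigr do rewrite big_ord_recr /=.
rewrite big_split /= IHn add0r -big_split big1 //= => i _.
by rewrite F_alt ?subrr // -ltnS.
Qed.

Variables (R : nzRingType) (N : lmodType R) (P : resolution N).
Variables (T : Type) (a : T -> R) (x : N).
Hypothesis aC : forall s t, a s * a t = a t * a s.
Hypothesis ax : forall t, a t *: x = 0.

(* Exactness provides the [z] below (see [koszul_diff]); [xget] returns the
   junk value 0 when there is none. *)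
Fixpoint koszul (n : nat) : (nat -> T) -> res_obj P n :=
  match n with
  | 0 => fun _ => xget 0 [set y | res_aug P y = x]
  | n'.+1 => fun l => xget 0 [set z | res_diff P n' z
      = \sum_(i < n'.+1) a (l i) *: ((-1) ^+ i *: koszul n' (l \o bump i))]
  end.

Lemma koszul_aug l : res_aug P (koszul 0 l) = x.
Proof.
by have [y yx] := res_surj P x; apply: (@xgetPex _ 0 [set y | _ y = x]); exists y.
Qed.

(** By exactness it suffices that the right side is a cycle. Its differential is a double sum over
    two successive deletions, [F i k] being the term that deletes entry i and then entry k of the
    rest; these terms cancel in pairs because the operators [a] commute. *)
Lemma koszul_diff n l : res_diff P n (koszul n.+1 l)
  = \sum_(i < n.+1) a (l i) *: ((-1) ^+ i *: koszul n (l \o bump i)).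
Proof.
elim: n l => [|n IHn] l.
  apply: (@xgetPex _ 0 [set z | _ z = _]); apply/res_exact0.
  by rewrite big_ord1 expr0 scale1r linearZ /= (koszul_aug l) ax.
apply: (@xgetPex _ 0 [set z | res_diff P n.+1 z = _]); apply/res_exactS.
pose F i k : res_obj P n := ((-1) ^+ (i + k) * (a (l i) * a (l (bump i k))))
  *: koszul n (l \o bump i \o bump k).
rewrite -[RHS](@alternating_double_sum _ F n.+1) => [|i k le_ik].
  rewrite linear_sum; apply: eq_bigr => i _ /=.
  rewrite linearZ /= linearZ /= IHn !scaler_sumr; apply: eq_bigr => k _.
  rewrite /F !scalerA exprD; congr (_ *: _).
  rewrite (commr_sign (a (l i))) -!mulrA; congr (_ * _).
  by rewrite mulrA commr_sign.
rewrite /F -scaleNr; congr (_ *: _).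
  rewrite -mulNr addSn addnC exprS mulN1r; congr (_ * _).
  by rewrite aC /bump ltnNge le_ik /= add0n add1n.
(* For i <= k, deleting k+1 and then i leaves the same list as deleting i and then k. *)
congr koszul; apply: funext => m /=; congr l.
by rewrite /bump; lia.
Qed.

End Koszul.

(** * Extensions of rank-one representations and their spliced cocycles *)

Section Extension.
Variables (E : lieType) (R : comAlgType rat) (theta theta' : lie_rep E R 0).
Variable e : E -> 'M[R]_1.
Hypothesis eD : {morph e : x y / x + y}.
Hypothesis eZ : forall c x, e (c *: x) = c%:A *: e x.
Hypothesis e_cocycle : forall x y, e (bracket x y)
  = (e x *m theta y + theta' x *m e y) - (e y *m theta x + theta' y *m e x).

(** The second coordinate is the submodule [theta'], the first the quotient [theta], and [e] is a
    1-cocycle with values in Hom(theta, theta'). *)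
Definition ext_fun (x : E) : 'M[R]_2 :=
  block_mx (theta x) 0 (e x) (theta' x) : 'M_(1 + 1).

Lemma ext_funD : {morph ext_fun : x y / x + y}.
Proof.
by move=> x y; rewrite /ext_fun !rep_addP eD (@add_block_mx _ 1 1 1 1) addr0.
Qed.

Lemma ext_funZ c x : ext_fun (c *: x) = c%:A *: ext_fun x.
Proof. by rewrite /ext_fun !rep_scaleP eZ (@scale_block_mx _ 1 1 1 1) scaler0. Qed.

Lemma ext_fun_bracket x y :
  ext_fun (bracket x y) = ext_fun x * ext_fun y - ext_fun y * ext_fun x.
Proof.
rewrite /ext_fun !rep_bracketP e_cocycle -!mulmxE.
rewrite !(@mulmx_block _ 1 1 1 1 1 1) !(mul0mx, mulmx0, addr0, add0r).
by rewrite (@opp_block_mx _ 1 1 1 1) (@add_block_mx _ 1 1 1 1) subrr.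
Qed.

Definition ext_rep : lie_rep E R 1 := LieRep ext_funD ext_funZ ext_fun_bracket.

Definition ext_in : 'M[R]_(2, 1) := col_mx 0 1%:M : 'M_(1 + 1, 1).
Definition ext_out : 'M[R]_(1, 2) := row_mx 1%:M 0 : 'M_(1, 1 + 1).

Lemma ext_inP x : ext_in *m theta' x = ext_rep x *m ext_in.
Proof.
by rewrite [RHS](@mul_block_col _ 1 1 1 1 1) [LHS](@mul_col_mx _ 1 1 1 1)
           !(mul0mx, mulmx0, mulmx1, mul1mx) !add0r.
Qed.

Lemma ext_outP x : ext_out *m ext_rep x = theta x *m ext_out.
Proof.
by rewrite [LHS](@mul_row_block _ 1 1 1 1 1) [RHS](@mul_mx_row _ 1 1 1 1)
           !(mul0mx, mulmx0, mulmx1, mul1mx) !addr0.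
Qed.

(** The value formula comes from the second coordinate of G(dp), the sum of the x_i G(q_i): when x_i
    acts by zero on [theta'], only [e (x i)] applied to the first coordinate of G(q_i), that is to
    g(q_i), survives. *)
Lemma lift_cocycle (N : lmodType (UE E)) (P : resolution N) n
    (g : {linear res_obj P n -> rep_mod theta}) :
  (forall x, g (res_diff P n x) = 0) ->
  exists g' : {linear res_obj P n.+1 -> rep_mod theta'},
    (forall x, g' (res_diff P n.+1 x) = 0) /\
    forall p m (x : 'I_m -> E) (q : 'I_m -> res_obj P n),
      (forall i, theta' (x i) = 0) ->
      res_diff P n p = \sum_i ue_gen (x i) *: q i ->
      g' p = \sum_i e (x i) *m g (q i).
Proof.
move=> gd0.
have outK (v : 'cV[R]_2) : ext_out *m v = usubmx (v : 'cV_(1 + 1)).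
  rewrite -[v in LHS](@vsubmxK _ 1 1 1) [LHS](@mul_row_col _ 1 1 1 1).
  by rewrite mul1mx mul0mx addr0.
have inK (v : 'cV[R]_1) : ext_in *m v = (col_mx 0 v : 'cV_(1 + 1)).
  by rewrite [LHS](@mul_col_mx _ 1 1 1 1) mul0mx mul1mx.
have [|c|b|G [g' [outG inG g'd]]] := @lift_extension _ _ P _ _ _
  (intertwiner ext_inP) (intertwiner ext_outP) _ g _ _ _ gd0.
- move=> u v uv; have : ext_in *m u = ext_in *m v := uv.
  by rewrite !inK => /(congr1 (@dsubmx _ 1 1 1)); rewrite !col_mxKd.
- exists (col_mx c 0 : 'cV_(1 + 1)).
  by apply: etrans (outK _) _; rewrite col_mxKu.
- move=> b0; exists (dsubmx (b : 'cV_(1 + 1))); apply: etrans (inK _) _.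
  have {}b0 : usubmx (b : 'cV_(1 + 1)) = 0 by rewrite -outK.
  by rewrite -b0 vsubmxK.
exists g'; split=> // p m x q theta'0 dp.
have : ext_in *m g' p = G (res_diff P n p) := inG p.
rewrite dp linear_sum inK => /(congr1 (@dsubmx _ 1 1 1)).
rewrite col_mxKd => ->; rewrite linear_sum; apply: eq_bigr => i _ /=.
have <- : ext_out *m G (q i) = g (q i) := outG (q i).
rewrite linearZ /= rep_mod_gen outK.
rewrite -[G (q i) in LHS](@vsubmxK _ 1 1 1).
rewrite [ext_rep _ *m _](@mul_block_col _ 1 1 1 1 1).
by rewrite col_mxKd theta'0 mul0mx addr0.
Qed.

End Extension.

(** * Lower central series of the lamplighter algebra and evaluations on its completion *)

Section LamplighterQuotients.

Lemma lie_span_dvd (d : {poly rat}) (G : set lamplighter) u :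
  (forall v, G v -> v.2 = 0 /\ dvdp d v.1) -> lie_span G u -> u.2 = 0 /\ dvdp d u.1.
Proof.
move=> G_dvd; elim=> [_ [c [w [/G_dvd [w2 dw] ->]]]||x y _ [x2 dx] _ [y2 dy]].
- by split; rewrite /= ?w2 ?[_ *: _]mulr0 // -mul_polyC dvdp_mull.
- by split; rewrite ?dvdp0.
- by split; rewrite /= ?x2 ?y2 ?subrr // dvdp_sub.
Qed.

(** The first bracket kills the t-component, and each bracket contributes a factor x. Hence the
    t-coordinate and the evaluations modulo y^(N+1) factor through a quotient of the tower. *)
Lemma lcs_lamplighter n (u : lamplighter) :
  lcs n.+1 u -> u.2 = 0 /\ dvdp 'X^(n.+1) u.1.
Proof.
elim: n u => [|n IHn] u; apply: lie_span_dvd => _ [v [w [Lw ->]]]; split=> //=.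
  by rewrite !scalerAr -mulrBr expr1 dvdp_mulIl.
have [w2 dw] := IHn w Lw.
rewrite w2 scale0r sub0r dvdpNr -mul_polyC dvdp_mull // exprS.
by rewrite dvdp_mul2l ?polyX_eq0.
Qed.

(** Since [t, x^n] = -x^(n+1). This makes successive truncations of a power series compatible in the
    tower. *)
Lemma lcs_monomial n : lcs n (('X^n, 0) : lamplighter).
Proof.
elim: n => // n IHn.
have -> : ('X^(n.+1), 0) = -1 *: bracket ((0, 1) : lamplighter) ('X^n, 0).
  congr pair => /=.
    by rewrite scale0r sub0r scale1r scaleN1r opprK exprS.
exact/lcsZ/lcs_bracket.
Qed.

Variables (N : nat) (c : rat).
Local Notation Q := {poly %/ ('X^(N.+1) : {poly rat})}.
Local Notation y := (in_qpoly 'X^(N.+1) 'X : Q).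

Lemma in_qpoly_dvd (p : {poly rat}) : dvdp 'X^(N.+1) p -> in_qpoly 'X^(N.+1) p = 0.
Proof.
move=> /dvdpP [q ->]; rewrite rmorphM /=.
suff -> : in_qpoly 'X^(N.+1) 'X^(N.+1) = 0 :> Q by rewrite mulr0.
(* The quotient ring works modulo [mk_monic] of the given polynomial, which here is X^(N+1)
   itself. *)
by apply: val_inj; rewrite /= mk_monic_Xn Pdiv.RingMonic.rmodpp ?monicXn.
Qed.

Definition eval_lamp (u : lamplighter) : Q :=
  in_qpoly 'X^(N.+1) (u.1 \Po (c *: 'X)).

Lemma eval_lamp_additive : zmod_morphism eval_lamp.
Proof. by move=> u v; rewrite /eval_lamp /= !raddfB. Qed.
HB.instance Definition _ :=
  GRing.isZmodMorphism.Build lamplighter Q eval_lamp eval_lamp_additive.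

Lemma eval_lamp_lcs u :
  ideal_set (lcs_lie_ideal lamplighter N.+1) u -> eval_lamp u = 0.
Proof.
move=> /lcs_lamplighter [_ /dvdpP [q uq]]; rewrite /eval_lamp.
rewrite uq comp_polyM comp_Xn_poly.
by apply: in_qpoly_dvd; rewrite exprZn -scalerAr -mul_polyC mulrA dvdp_mulIr.
Qed.

Lemma eval_lampZ a u : eval_lamp (a *: u) = a *: eval_lamp u.
Proof. by rewrite /eval_lamp /= comp_polyZ linearZ. Qed.

Lemma eval_lamp_bracket u v : eval_lamp (bracket u v)
  = (v.2 * c) *: (y * eval_lamp u) - (u.2 * c) *: (y * eval_lamp v).
Proof.
rewrite /eval_lamp /= raddfB /= !comp_polyZ !comp_polyM !comp_polyX raddfB /=.
by rewrite -!scalerAl !scalerA !in_qpolyZ !rmorphM.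
Qed.

Definition t_lamp (u : lamplighter) : rat := u.2.
Lemma t_lamp_additive : zmod_morphism t_lamp. Proof. by []. Qed.
HB.instance Definition _ :=
  GRing.isZmodMorphism.Build lamplighter rat t_lamp t_lamp_additive.

Lemma t_lamp_lcs u : ideal_set (lcs_lie_ideal lamplighter N.+1) u -> t_lamp u = 0.
Proof. by case/lcs_lamplighter. Qed.

Local Notation E := (completion lamplighter).

Local Notation J := (lcs_lie_ideal lamplighter N.+1).

Lemma coord_bracket (u v : E) : Defs.coord (bracket u v) N.+1
  = liequo_pi J (bracket (repr (Defs.coord u N.+1)) (repr (Defs.coord v N.+1)))
  :> liequo J.
Proof. by rewrite liequo_pi_bracket !liequo_piK. Qed.

(** Coordinate N+1 is the quotient by [lcs N.+1], inside x^(N+1) Q[x]; coordinate N would be too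
    coarse, as [lcs N] contains x^N. *)
Definition t_coord (u : E) : rat := quo_lift t_lamp_lcs (Defs.coord u N.+1).
Definition eval_coord (u : E) : Q := quo_lift eval_lamp_lcs (Defs.coord u N.+1).

Lemma quo_lift_Z (V : lmodType rat) (f : {additive lamplighter -> V})
    (f0 : forall x, ideal_set (lcs_lie_ideal lamplighter N.+1) x -> f x = 0) a x :
  (forall u, f (a *: u) = a *: f u) ->
  quo_lift f0 (a *: x : liequo (lcs_lie_ideal lamplighter N.+1))
    = a *: quo_lift f0 x.
Proof.
move=> fZ; rewrite -[x]liequo_piK -[a *: _]liequo_piZ.
by rewrite !(@quo_lift_pi _ _ _ f f0) fZ.
Qed.

Lemma t_coordD : {morph t_coord : u v / u + v}.
Proof. by move=> u v; exact: (raddfD (quo_lift t_lamp_lcs)). Qed.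

Lemma t_coordZ a u : t_coord (a *: u) = a * t_coord u.
Proof. exact: (@quo_lift_Z rat^o). Qed.

Lemma t_coord_bracket u v : t_coord (bracket u v) = 0.
Proof.
by rewrite /t_coord coord_bracket [LHS](quo_lift_pi t_lamp_lcs).
Qed.

Lemma eval_coordD : {morph eval_coord : u v / u + v}.
Proof. by move=> u v; exact: (raddfD (quo_lift eval_lamp_lcs)). Qed.

Lemma eval_coordZ a u : eval_coord (a *: u) = a *: eval_coord u.
Proof. by apply: quo_lift_Z => x; exact: eval_lampZ. Qed.

Lemma eval_coord_bracket u v : eval_coord (bracket u v)
  = (t_coord v * c) *: (y * eval_coord u) - (t_coord u * c) *: (y * eval_coord v).
Proof.
rewrite /eval_coord coord_bracket [LHS](quo_lift_pi eval_lamp_lcs).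
exact: eval_lamp_bracket.
Qed.

End LamplighterQuotients.

(** * Power series as elements of the completion *)

Section Series.
Variable f : nat -> rat.

Definition trunc n : lamplighter := (\poly_(r < n) f r, 0).

Lemma trunc_trans n : @lcsquo_trans lamplighter n
  (liequo_pi (lcs_lie_ideal lamplighter n.+1) (trunc n.+1))
  = liequo_pi (lcs_lie_ideal lamplighter n) (trunc n).
Proof.
rewrite lcsquo_trans_pi; apply/liequo_piP => /=.
have -> : trunc n.+1 - trunc n = f n *: (('X^n, 0) : lamplighter).
  congr pair; rewrite /= ?subr0 ?[_ *: _]mulr0 // poly_def big_ord_recr /=.
  by rewrite -poly_def addrAC subrr add0r.
exact/lcsZ/lcs_monomial.
Qed.

Definition series : completion lamplighter :=
  @Invlim (lcs_tower lamplighter) _ trunc_trans.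

Lemma t_coord_series N : t_coord N series = 0.
Proof. exact: quo_lift_pi. Qed.

Lemma eval_coord_series N c : eval_coord N c series
  = in_qpoly 'X^(N.+1) (\poly_(r < N.+1) (f r * c ^+ r)).
Proof.
have -> : eval_coord N c series = eval_lamp N c (trunc N.+1) by exact: quo_lift_pi.
rewrite /eval_lamp /trunc /=; congr in_qpoly.
rewrite !poly_def raddf_sum /=; apply: eq_bigr => r _.
by rewrite comp_polyZ comp_Xn_poly exprZn scalerA.
Qed.

End Series.

Lemma bracket_series f g : bracket (series f) (series g) = 0.
Proof.
apply: invlim_ext => n; rewrite /= -[bracket _ _]liequo_pi_bracket.
rewrite [bracket _ _](_ : _ = 0) ?raddf0 //.
by congr pair; rewrite /= !scale0r subrr.
Qed.

(** * Trivial representations and relations between generators of [UE E] *)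

Lemma free_rep_trivial (E : lieType) (R : comAlgType rat) n (rho : lie_rep E R n)
    u : (forall x, rho x = 0) -> free_rep rho u = ((free_aug u)%:A)%:M.
Proof.
move=> rho0; rewrite -[RHS]/(scalar_rep R n (free_aug u)).
rewrite (monalgE u) (raddf_sum (free_rep rho)) (raddf_sum (@free_aug E)).
rewrite (raddf_sum (scalar_rep R n)); apply: eq_bigr => w _ /=.
rewrite /free_rep mmapU /= /free_aug mcoeffU /scalar_rep /=.
(* Only the empty word contributes: any other word has a factor [rho x] = 0. *)
have [->|w1] := eqVneq w mone.
  by rewrite /word_rep fm1 big_nil mulr1.
rewrite mulr0n scale0r raddf0 /word_rep.
case: w w1 => [[|x s]] w1; first by rewrite -fm1 fmK eqxx in w1.
by rewrite big_cons rho0 mul0r mulr0.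
Qed.

Lemma ue_rep_trivial (E : lieType) (R : comAlgType rat) n (rho : lie_rep E R n) a :
  (forall x, rho x = 0) -> ue_rep rho a = ((ue_aug a)%:A)%:M.
Proof.
move=> rho0; rewrite -[a]ringquo_piK ue_rep_pi [ue_aug _]ue_aug_pi.
exact: free_rep_trivial.
Qed.

Section TrivialInclusion.
Variables (E : lieType) (R : comAlgType rat) (n : nat) (rho : lie_rep E R n).

(** Composed with the augmentation of a resolution, this gives the degree-0 cocycle from which the
    splicing starts. *)
Definition const_col of (forall x, rho x = 0) := fun r : trivl E =>
  (r%:A *: (const_mx 1) : rep_mod rho).

Hypothesis rho0 : forall x, rho x = 0.

Lemma const_col_linear : linear (const_col rho0).
Proof.
move=> a r s; rewrite /const_col !scalerDl; congr (_ + _).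
rewrite [RHS](_ : _ = ue_rep rho a *m (r%:A *: const_mx 1)) //.
rewrite ue_rep_trivial // mul_scalar_mx scalerA.
exact: (congr1 (fun z : R => z *: (const_mx 1 : 'cV[R]_n.+1))
  (rmorphM (in_alg R) (ue_aug a) r)).
Qed.
HB.instance Definition _ := GRing.isLinear.Build (UE E) (trivl E) (rep_mod rho) _
  (const_col rho0) const_col_linear.
End TrivialInclusion.

Lemma ue_pi_rel (E : lieType) (u : free_alg E) : ue_rel u -> ue_pi u = 0.
Proof.
move=> rel_u; rewrite -(raddf0 (@ue_pi E)).
apply: (proj2 (quo_piP (two_sided (@ue_rel E)) u 0)).
by apply: sg_gen; exists 1, u, 1; rewrite subr0 mulr1 mul1r.
Qed.

Lemma ue_genM (E : lieType) (x y : E) :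
  ue_gen x * ue_gen y = ue_pi (free_gen x * free_gen y).
Proof. exact/esym/(rmorphM (@ue_pi E)). Qed.

Lemma ue_gen_bracket (E : lieType) (x y : E) :
  ue_gen x * ue_gen y - ue_gen y * ue_gen x - ue_gen (bracket x y) = 0.
Proof.
rewrite !ue_genM; have := ue_pi_rel (ue_bracket x y).
by rewrite (raddfB (@ue_pi E)) /= (raddfB (@ue_pi E)).
Qed.

Lemma ue_gen0 (E : lieType) : ue_gen (0 : E) = 0.
Proof. by have := ue_pi_rel (ue_scale 0 (0 : E)); rewrite !scale0r subr0. Qed.

Lemma ue_gen_comm (E : lieType) (x y : E) :
  bracket x y = 0 -> ue_gen x * ue_gen y = ue_gen y * ue_gen x.
Proof.
by move=> xy0; have := ue_gen_bracket x y; rewrite xy0 ue_gen0 subr0 => /subr0_eq.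
Qed.

(** The cocycle condition in rank one: t acts by -s y on the source and by -(s + c) y on the target,
    and the difference c y is what multiplication by x becomes under f |-> f(cy). *)
Lemma cocycle_identity (R : comAlgType rat) (y a b : R) (s c t t' : rat) :
  (t' * c) *: (y * a) - (t * c) *: (y * b)
  = a * ((- s * t') *: y) + ((- (s + c) * t) *: y) * b
    - (b * ((- s * t) *: y) + ((- (s + c) * t') *: y) * a).
Proof.
rewrite -!scalerAl -!scalerAr (mulrC a) (mulrC b).
rewrite (addrC ((- s * t) *: _)) [- (_ *: _ + _)]opprD addrACA.
rewrite -!scalerBl -scaleNr.
by congr (_ *: _ + _ *: _); ring.
Qed.

(** * The spliced cocycles and their determinant values on Koszul chains *)

Section Cocycles.
Local Notation E := (completion lamplighter).
Variables (N : nat) (c : nat -> rat) (P : resolution (trivl E)).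
Local Notation Q := {poly %/ ('X^(N.+1) : {poly rat})}.
Local Notation y := (in_qpoly 'X^(N.+1) 'X : Q).

(* The twist after splicing the first [k] extensions: each one shifts the
   action of t by -c y. *)
Definition character_fun (k : nat) (u : E) : 'M[Q]_1 :=
  ((- (\sum_(i < k) c i) * t_coord N u) *: y)%:M.

Lemma character_add k : {morph character_fun k : u v / u + v}.
Proof. by move=> u v; rewrite /character_fun t_coordD mulrDr scalerDl raddfD. Qed.

Lemma character_scale k a u : character_fun k (a *: u) = a%:A *: character_fun k u.
Proof.
by rewrite /character_fun t_coordZ scale_scalar_mx mulr_algl scalerA mulrCA.
Qed.

Lemma character_bracket k u v : character_fun k (bracket u v)
  = character_fun k u * character_fun k v - character_fun k v * character_fun k u.
Proof.
rewrite /character_fun t_coord_bracket mulr0 scale0r raddf0.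
by rewrite -!mulmxE scalar_mxC subrr.
Qed.

Definition character k : lie_rep E Q 0 :=
  LieRep (@character_add k) (@character_scale k) (@character_bracket k).

Definition eval_cocycle (k : nat) (u : E) : 'M[Q]_1 := (eval_coord N (c k) u)%:M.

Lemma eval_cocycleD k : {morph eval_cocycle k : u v / u + v}.
Proof. by move=> u v; rewrite /eval_cocycle eval_coordD raddfD. Qed.

Lemma eval_cocycleZ k a u : eval_cocycle k (a *: u) = a%:A *: eval_cocycle k u.
Proof. by rewrite /eval_cocycle eval_coordZ scale_scalar_mx mulr_algl. Qed.

Lemma eval_cocycle_bracket k u v : eval_cocycle k (bracket u v)
  = (eval_cocycle k u *m character k v + character k.+1 u *m eval_cocycle k v)
    - (eval_cocycle k v *m character k u + character k.+1 v *m eval_cocycle k u).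
Proof.
rewrite /eval_cocycle /= /character_fun eval_coord_bracket -!scalar_mxM.
rewrite -!(raddfD (@scalar_mx Q 1)) -(raddfB (@scalar_mx Q 1)) big_ord_recr.
exact: (congr1 (@scalar_mx Q 1) (cocycle_identity _ _ _ _ _ _ _)).
Qed.

Definition series_koszul := koszul P
  (fun f => ue_gen (series f)) (1 : rat).

Lemma series_koszul_diff n l : res_diff P n (series_koszul n.+1 l)
  = \sum_(i < n.+1) ue_gen (series (l i))
      *: ((-1) ^+ i *: series_koszul n (l \o bump i)).
Proof.
apply: koszul_diff => [f g|f]; first exact/ue_gen_comm/bracket_series.
by rewrite [LHS]/GRing.scale /= /trivl_scale [ue_aug _]ue_aug_pi free_aug_gen mul0r.
Qed.

(* The newest cocycle [c n.-1] is the top row, so that adding one more is the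
   Laplace expansion along row 0, with the signs of the Koszul differential. *)
Definition eval_det n (l : nat -> nat -> rat) : Q :=
  \det (\matrix_(k < n, i < n) eval_coord N (c (n.-1 - k)%N) (series (l i))).

Lemma eval_detS n l : eval_det n.+1 l
  = \sum_(i < n.+1) eval_coord N (c n) (series (l i))
      * ((-1) ^+ i * eval_det n (l \o bump i)).
Proof.
rewrite /eval_det (expand_det_row _ ord0); apply: eq_bigr => i _.
rewrite mxE subn0 /cofactor add0n; congr (_ * (_ * \det _)).
apply/matrixP => k j; rewrite !mxE.
by have -> : (n.+1.-1 - lift ord0 k = n.-1 - k)%N by rewrite lift0 /=; lia.
Qed.

(** Induction on n, one splice per step. Series have no t-component, so they act by zero through
    every character, and the value formula of [lift_cocycle] turns the Koszul differential into the
    expansion [eval_detS]. *)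
Lemma series_cocycle n :
  exists g : {linear res_obj P n -> rep_mod (character n)},
    (forall x, g (res_diff P n x) = 0) /\
    forall l, g (series_koszul n l) = (eval_det n l)%:M.
Proof.
elim: n => [|n [g [gd gE]]].
  have ch0 u : character 0 u = 0.
    by rewrite /= /character_fun big_ord0 oppr0 mul0r scale0r raddf0.
  exists (const_col ch0 \o res_aug P); split=> [x|l] /=.
    by rewrite res_aug_diff linear0.
  rewrite (koszul_aug P (fun f => ue_gen (series f)) (1 : rat) l).
  rewrite /const_col /eval_det det_mx00 scale1r scale1r.
  by apply/matrixP => i j; rewrite !ord1 !mxE.
have [g' [g'd g'E]] := lift_cocycle (@eval_cocycleD n) (@eval_cocycleZ n)
  (@eval_cocycle_bracket n) gd.
exists g'; split=> // l.
rewrite (g'E _ _ _ _ _ (series_koszul_diff n l)) => [|i]; last first.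
  by rewrite /= /character_fun t_coord_series mulr0 scale0r raddf0.
rewrite eval_detS raddf_sum; apply: eq_bigr => i _ /=.
rewrite scalar_mxM; congr (_ *m _).
(* The sign is a scalar of [UE E] on one side and an element of Q[y]/(y^(N+1)) on the other; both
   are reduced to the parity of i. *)
rewrite -signr_odd -[(-1) ^+ i]signr_odd scaler_sign mulr_sign; case: odd.
  by rewrite linearN /= gE raddfN.
by rewrite gE.
Qed.

End Cocycles.

(** * Generalized Vandermonde determinants *)

Section GeneralizedVandermonde.
Variables (n : nat) (d : 'I_n.+2 -> rat).
Hypotheses (d_inj : injective d) (d_neq0 : forall k, d k != 0).

Lemma Vandermonde_unit m (b : 'I_m -> rat) :
  injective b -> Vandermonde m (\row_k b k) \in unitmx.
Proof.
move=> b_inj; rewrite unitmxE unitfE det_Vandermonde.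
apply/prodf_neq0 => i _; apply/prodf_neq0 => j lt_ij; rewrite !mxE subr_eq0.
by apply: contraTneq lt_ij => /b_inj ->; rewrite ltnn.
Qed.

(** The cofactor of row k and the last column in the matrix of powers d_k^i; up to sign it is the
    Vandermonde determinant of the remaining nodes. *)
Definition minor_weight (k : 'I_n.+2) : rat :=
  (-1) ^+ (k + n.+1) * \det (\matrix_(i < n.+1, j < n.+1) d (lift k i) ^+ j).

Lemma minor_weight_neq0 k : minor_weight k != 0.
Proof.
rewrite mulf_neq0 ?signr_eq0 // -det_tr.
rewrite (_ : _^T = Vandermonde n.+1 (\row_i d (lift k i))).
  by rewrite -unitfE -unitmxE; apply: Vandermonde_unit => i j /d_inj /lift_inj.
by apply/matrixP => i j; rewrite !mxE.
Qed.

(** The determinant with exponents 0, ..., n, m, expanded along its last column. *)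
Definition weighted_power_sum m := \sum_k minor_weight k * d k ^+ m.

(** If n+2 consecutive sums vanished, the invertible Vandermonde matrix of the d_k would kill the
    vector [u], whose entries are all nonzero. *)
Lemma weighted_power_sum_window m0 :
  exists2 i, (i < n.+2)%N & weighted_power_sum (m0 + i) != 0.
Proof.
apply: contrapT => all0.
pose u := \col_k (minor_weight k * d k ^+ m0).
have Vu : Vandermonde n.+2 (\row_k d k) *m u = 0.
  apply/matrixP => i j; rewrite !mxE.
  have [|ne0] := eqVneq (weighted_power_sum (m0 + i)) 0; last first.
    by case: all0; exists i.
  move=> wps0; rewrite -[RHS]wps0 /weighted_power_sum; apply: eq_bigr => k _.
  rewrite !mxE exprD; ring.
have /colP/(_ ord0) : u = 0.
  by rewrite -(mulKmx (Vandermonde_unit d_inj) u) Vu mulmx0.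
rewrite !mxE => /eqP; rewrite mulf_eq0 (negPf (minor_weight_neq0 _)) /=.
by rewrite expf_eq0 (negPf (d_neq0 _)) andbF.
Qed.

(** Expand along the last column: in every minor, column j has the common factor X^j, and what
    remains is rational. *)
Lemma det_last_column (F : 'I_n.+2 -> {poly rat}) :
  \det (\matrix_(k < n.+2, i < n.+2)
    (if (i < n.+1)%N then d k ^+ i *: 'X^i else F k))
  = (\sum_k minor_weight k *: F k) * 'X^(\sum_(j < n.+1) j).
Proof.
rewrite (expand_det_col _ ord_max) mulr_suml; apply: eq_bigr => k _.
rewrite mxE ltnn /cofactor.
set B := row' _ _.
have -> : B = map_mx polyC (\matrix_(i < n.+1, j < n.+1) d (lift k i) ^+ j)
              *m diag_mx (\row_j 'X^j).
  apply/matrixP => i j; rewrite mul_mx_diag !mxE lift_max ltn_ord.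
  by rewrite mul_polyC.
rewrite det_mulmx det_diag det_map_mx.
under [X in _ * (_ * (_ * X))]eq_bigr do rewrite mxE.
rewrite -expr_sum.
rewrite /minor_weight -mul_polyC polyCM rmorphXn rmorphN rmorph1 /=; ring.
Qed.

End GeneralizedVandermonde.

(** * Additive functionals on tensor products *)

Section TensorMaps.
Variables (R : nzRingType) (M : lmodType R^c) (N : lmodType R).

Lemma tens_pureZ0 (a : R) (m : M) (n : N) :
  (a : R^c) *: m = 0 -> tens_pure m (a *: n) = 0.
Proof.
move=> am0; rewrite -tens_pure_bal am0; apply: (@addrI _ (tens_pure (0 : M) n)).
by rewrite -tens_pureDl !addr0.
Qed.

Lemma tens_pure_sum (m : M) I (r : seq I) (F : I -> N) :
  tens_pure m (\sum_(i <- r) F i) = \sum_(i <- r) tens_pure m (F i).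
Proof.
apply: (big_morph (tens_pure m) (@tens_pureDr _ _ _ m)).
by rewrite -(scale0r (0 : N)) tens_pureZ0 // (scale0r (m : M)).
Qed.

Lemma tens_additive_eq0 (V : zmodType) (psi : {additive tens M N -> V}) :
  (forall m n, psi (tens_pure m n) = 0) -> forall t, psi t = 0.
Proof.
move=> psi0 t; rewrite -[t]quo_piK (monalgE (repr t)).
rewrite (raddf_sum (quo_pi (@tens_rel R M N))) /= raddf_sum big1_fset // => p _ _.
have -> : << (repr t : tens_free M N)@_p *g p >>
    = (tens_gen p.1 p.2 : tens_free M N) *~ (repr t : tens_free M N)@_p.
  rewrite /tens_gen -surjective_pairing.
  by rewrite -[in LHS](intz (_@_p)) -(raddfMz (mkmalgU p)).
by rewrite (raddfMz (quo_pi (@tens_rel R M N))) raddfMz psi0 mul0rz.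
Qed.

End TensorMaps.

Section TensorFunctional.
Variables (E : lieType) (R : comAlgType rat) (rho : lie_rep E R 0).
Hypothesis rho0 : forall x, rho x = 0.
Variables (N : lmodType (UE E)) (g : {linear N -> rep_mod rho}).

(** The functional sending r tensor x to r g(x). It respects the balancing relation because [rho] is
    zero, so that [UE E] acts through the augmentation on both factors. *)
Definition tens_free_eval : tens_free (trivr E) N -> R :=
  mmap (intmul 1 : int -> R)
    (fun p : trivr E * N => (p.1 : rat)%:A * (g p.2 : 'cV_1) 0 0).
HB.instance Definition _ := GRing.Additive.on tens_free_eval.

Lemma tens_free_eval_gen r x :
  tens_free_eval (tens_gen r x) = (r : rat)%:A * (g x : 'cV_1) 0 0.
Proof. by rewrite /tens_free_eval mmapU /= mul1r. Qed.

Lemma tens_free_evalB u v :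
  tens_free_eval (u - v) = tens_free_eval u - tens_free_eval v.
Proof. exact: raddfB. Qed.

Lemma tens_free_evalD u v :
  tens_free_eval (u + v) = tens_free_eval u + tens_free_eval v.
Proof. exact: raddfD. Qed.

Lemma tens_free_eval_rel u : tens_rel u -> tens_free_eval u = 0.
Proof.
case=> [r r' x|r x x'|a r x]; rewrite tens_free_evalB ?tens_free_evalD;
  rewrite !tens_free_eval_gen; apply/eqP; rewrite subr_eq0; apply/eqP.
- by rewrite -mulrDl -scalerDl.
- by rewrite linearD mxE mulrDr.
- rewrite linearZ /= [a *: g x](_ : _ = ue_rep rho a *m g x) // ue_rep_trivial //.
  rewrite mul_scalar_mx mxE mulrA; congr (_ * _).
  rewrite [X in X%:A](_ : _ = ue_aug a * r) // mulrC; exact: (rmorphM (in_alg R)).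
Qed.

Definition tens_eval : tens (trivr E) N -> R := quo_lift tens_free_eval_rel.
HB.instance Definition _ := GRing.Additive.on tens_eval.

Lemma tens_eval_pure r x :
  tens_eval (tens_pure r x) = (r : rat)%:A * (g x : 'cV_1) 0 0.
Proof. by rewrite [LHS]quo_lift_pi; exact: tens_free_eval_gen. Qed.

End TensorFunctional.

(** * Separation of series by the determinants *)

Section Detection.
Variable n : nat.

(** Sum zero makes the last twist trivial. The nodes 1, ..., n+1 are positive and the last one is
    negative, so all are distinct and nonzero. *)
Definition nodes (k : nat) : rat :=
  if (k < n.+1)%N then k.+1%:R else - \sum_(i < n.+1) i.+1%:R.

Lemma nodes_sum : \sum_(k < n.+2) nodes k = 0.
Proof.
rewrite big_ord_recr /= /nodes ltnn; apply/eqP; rewrite subr_eq0; apply/eqP.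
by apply: eq_bigr => k _; rewrite /= ltn_ord.
Qed.

(** Follows the row order of [eval_det], which starts from the newest cocycle. *)
Definition rev_node (k : 'I_n.+2) : rat := nodes (n.+1 - k).

Lemma last_node_lt0 : - \sum_(i < n.+1) i.+1%:R < 0 :> rat.
Proof. by rewrite oppr_lt0 big_ord_recl ltr_wpDr ?sumr_ge0 ?ltr01. Qed.

Lemma rev_node_neq0 k : rev_node k != 0.
Proof.
rewrite /rev_node /nodes; case: ifP => _; first by rewrite pnatr_eq0.
exact/ltr0_neq0/last_node_lt0.
Qed.

Lemma rev_node_inj : injective rev_node.
Proof.
move=> i j ij; apply: rev_ord_inj; apply: val_inj => /=; rewrite !subSS.
have /= [iS jS] := (ltn_ord (rev_ord i), ltn_ord (rev_ord j)).
rewrite !subSS in iS jS.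
move: ij; rewrite /rev_node /nodes !ltnS.
have [ilt|ige] := leqP (n.+1 - i)%N n; have [jlt|jge] := leqP (n.+1 - j)%N n.
- by move/eqP; rewrite eqr_nat => /eqP [].
- by move=> ij; have := last_node_lt0; rewrite -ij ltrn0.
- by move=> ij; have := last_node_lt0; rewrite ij ltrn0.
- by move=> _; lia.
Qed.

Definition test_series (f : nat -> rat) (i : nat) : nat -> rat :=
  if (i < n.+1)%N then fun r => (r == i)%:R else f.

Local Notation M := (\sum_(j < n.+1) j)%N.

Lemma eval_det_test N f : (n <= N)%N ->
  eval_det N nodes n.+2 (test_series f) = in_qpoly 'X^(N.+1)
    ((\sum_k minor_weight rev_node k *:
        \poly_(r < N.+1) (f r * rev_node k ^+ r)) * 'X^M).
Proof.
move=> le_nN; rewrite -det_last_column -det_map_mx; congr (\det _).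
apply/matrixP => k i; rewrite !mxE eval_coord_series; congr in_qpoly.
rewrite /test_series; case: ifP => // lt_in; apply/polyP => r.
rewrite coef_poly coefZ coefXn; case: eqP => [->|_]; last first.
  by rewrite mul0r mulr0 if_same.
(* The bound n <= N keeps the monomials x^i, i <= n, below the truncation order. *)
by rewrite mul1r mulr1 ltnS (leq_trans _ le_nN).
Qed.

Lemma in_qpoly_coef N (p p' : {poly rat}) r : (r <= N)%N ->
  in_qpoly 'X^(N.+1) p = in_qpoly 'X^(N.+1) p' -> p`_r = p'`_r.
Proof.
move=> le_rN /(congr1 val) /=; rewrite mk_monic_Xn => eq_mod.
rewrite (Pdiv.RingMonic.rdivp_eq (monicXn _ N.+1) p).
rewrite [p' in RHS](Pdiv.RingMonic.rdivp_eq (monicXn _ N.+1)).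
by rewrite !coefD !coefMXn ltnS le_rN !add0r eq_mod.
Qed.

(** The coefficient of y^(m+M) in the determinant is f_m times the generalized Vandermonde
    determinant of exponent m, and m + M <= N lets it survive modulo y^(N+1). *)
Lemma eval_det_coef N f f' m : (n <= N)%N -> (m + M <= N)%N ->
  eval_det N nodes n.+2 (test_series f) = eval_det N nodes n.+2 (test_series f') ->
  weighted_power_sum rev_node m != 0 -> f m = f' m.
Proof.
move=> le_nN le_mN; rewrite !eval_det_test // => /(in_qpoly_coef le_mN).
have coefE g : ((\sum_k minor_weight rev_node k *:
    \poly_(r < N.+1) (g r * rev_node k ^+ r)) * 'X^M)`_(m + M)
    = g m * weighted_power_sum rev_node m.
  rewrite coefMXn ltnNge leq_addl addnK coef_sum mulr_sumr; apply: eq_bigr => k _.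
  by rewrite coefZ coef_poly ltnS (leq_trans (leq_addr _ _) le_mN) mulrCA.
by rewrite !coefE => eq_mul ne0; apply: (mulIf ne0).
Qed.

(* Constant on windows of n.+2 degrees, each of which contains a degree seen by
   the determinant. *)
Definition window_series (S : nat -> bool) (r : nat) : rat := (S (r %/ n.+2)%N)%:R.

Lemma window_series_separated S S' :
  (forall N, eval_det N nodes n.+2 (test_series (window_series S))
    = eval_det N nodes n.+2 (test_series (window_series S'))) -> S = S'.
Proof.
move=> eq_det; apply: funext => j.
have [i lt_i ne0] :=
  weighted_power_sum_window rev_node_inj rev_node_neq0 (j * n.+2).
(* With m = j(n+2) + i, the order N = n + (m + M) meets both bounds, and m lies in window j, where
   the two series are constantly S j and S' j. *)
have := @eval_det_coef (n + (j * n.+2 + i + M)) _ _ _ _ _ (eq_det _) ne0.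
rewrite /window_series divnMDl // divn_small // addn0 => /(_ _ _)/eqP.
rewrite leq_addr leq_addl eqr_nat => /(_ isT isT); by case: (S j); case: (S' j).
Qed.

End Detection.

(** * Uncountable homology and nonzero Ext in degree n+2, for any resolution *)

Lemma trivr_gen (F : lieType) (x : F) r : trivr_scale (ue_gen x) r = 0.
Proof. by rewrite /trivr_scale [ue_aug _]ue_aug_pi free_aug_gen mul0r. Qed.

Section Classes.
Variable n : nat.
Local Notation E := (completion lamplighter).
Local Notation q := n.+2.
Variable P : resolution (trivl E).

Local Notation test_family S := (test_series n (window_series n S)).
Local Notation test_det N S := (eval_det N (nodes n) q (test_family S)).
Local Notation boundary := (tens_map (M := trivr E) (res_diff P q)).

Lemma character_nodes N u : character N (nodes n) q u = 0.
Proof. by rewrite /= /character_fun nodes_sum oppr0 mul0r scale0r raddf0. Qed.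

Definition test_cycle (S : nat -> bool) : tens (trivr E) (res_obj P q) :=
  @tens_pure (UE E) (trivr E) (res_obj P q) (1 : rat)
    (series_koszul P q (test_family S)).

(** Each term of the Koszul differential carries a generator, which moves across the tensor and acts
    by zero on [trivr]. *)
Lemma test_cycleP S : tens_map (M := trivr E) (res_diff P n.+1) (test_cycle S) = 0.
Proof.
rewrite tens_map_pure series_koszul_diff tens_pure_sum big1 // => i _.
by apply: tens_pureZ0; exact: trivr_gen.
Qed.

(** For every N the cocycle [g] induces a functional that kills boundaries and sends a test cycle to
    its determinant; homologous test cycles thus have equal determinants for all N. *)
Lemma test_class_inj S S' :
  quo_pi (range boundary) (test_cycle S)
  = quo_pi (range boundary) (test_cycle S') -> S = S'.
Proof.
move=> /quo_piP SS'; apply: (@window_series_separated n) => N.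
have [g [gd gE]] := series_cocycle N (nodes n) P q.
pose psi : {additive tens (trivr E) (res_obj P q) -> _} :=
  tens_eval (character_nodes N) g.
have psiE T : psi (test_cycle T) = test_det N T.
  by rewrite [LHS]tens_eval_pure gE mxE scale1r mul1r.
have psi_boundary t : range boundary t -> psi t = 0.
  move=> [s _ <-].
  apply: (@tens_additive_eq0 _ _ _ _ (psi \o boundary)).
  by move=> m x /=; rewrite tens_map_pure [LHS]tens_eval_pure gd mxE mulr0.
have := subgroup_gen_lift psi_boundary SS'.
by rewrite (raddfB psi) !psiE => /subr0_eq.
Qed.

Lemma Tor_uncountable : ~ countable (@Tor_of (UE E) (trivl E) (trivr E) P q).
Proof.
move=> /countable_injP [f f_inj].
pose h S := f (quo_pi (range boundary) (test_cycle S)).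
have h_inj : injective h.
  move=> S S' hS; apply: test_class_inj; apply: f_inj hS; apply: mem_set.
    by exists (test_cycle S); first exact: test_cycleP.
  by exists (test_cycle S'); first exact: test_cycleP.
(* Cantor's diagonal argument against an injection [h] of the subsets of nat into nat. *)
pose D k := `[< exists2 S, h S = k & ~~ S k >].
have [DD|nDD] := boolP (D (h D)).
  by have /asboolP [S /h_inj SD] := DD; rewrite SD DD.
have : D (h D) by apply/asboolP; exists D.
by rewrite (negPf nDD).
Qed.

(** Separating two sequences yields an N at which some test determinant, a value of [g], is nonzero.
    A coboundary vanishes on Koszul chains because E acts by zero on the coefficients. *)
Lemma Ext_neq0 : exists M : lmodType (UE E), ~ @Ext_of _ _ P M q `<=` [set 0].
Proof.
pose S0 := fun _ : nat => false; pose S1 := fun _ : nat => true.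
have [N neq_det] : exists N, test_det N S1 <> test_det N S0.
  apply: contrapT => eq_det; have : S1 = S0.
    apply: (@window_series_separated n) => N; apply: contrapT => neq_det.
    by apply: eq_det; exists N.
  by move/(congr1 (@^~ 0%N)).
have [g [gd gE]] := series_cocycle N (nodes n) P q.
pose Q0 := rep_mod (character N (nodes n) q) : lmodType (UE E).
exists Q0 => Ext0.
pose p S := series_koszul P q (test_family S).
have coboundary0 S f : subgroup_gen (@coboundaries _ _ P Q0 q) f -> f (p S) = 0.
  elim=> [f' [h f'E]||f1 f2 _ f1p _ f2p] //=; last first.
    by rewrite [LHS](_ : _ = f1 (p S) - f2 (p S)) // f1p f2p subrr.
  rewrite f'E /p series_koszul_diff linear_sum big1 // => i _.
  rewrite linearZ /= rep_mod_gen [character _ _ _ _]character_nodes; exact: mul0mx.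
have gcl : @Ext_of _ _ P Q0 q (quo_pi (@coboundaries _ _ P Q0 q) g).
  by exists (g : _ -> _) => //; split=> //; exact: linearP.
have /quo_piP g_cob := etrans (Ext0 _ gcl)
  (esym (raddf0 (quo_pi (@coboundaries _ _ P Q0 q)))).
apply: neq_det.
have det0 S : test_det N S = 0.
  have := coboundary0 S _ g_cob.
  rewrite [LHS](_ : _ = g (p S) - 0) // subr0 gE => /matrixP/(_ 0 0).
  by rewrite !mxE.
by rewrite !det0.
Qed.

End Classes.

Theorem theorem2 :
  (forall q : nat, (2 <= q)%N ->
     ~ countable (lie_homology (completion lamplighter) q)) /\
  cohomological_dimension (completion lamplighter) = +oo%E.
Proof.
split=> [[|[|n]] // _|]; first exact: Tor_uncountable.
rewrite /cohomological_dimension; set A := (X in supremum _ X).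
have A_ge2 n : A (n.+2%:Z%:E)%E.
  have [M ExtM] := Ext_neq0 n (free_resolution (trivl (completion lamplighter))).
  by exists n.+2 => //; exists M.
have A_top : supremums A +oo%E.
  split=> [z _|[b||] ub_b //]; first exact: leey.
    (* An integer bound b is exceeded by the degree |b| + 2. *)
    by have := ub_b _ (A_ge2 `|b|%N); rewrite lee_fin; lia.
  by have := ub_b _ (A_ge2 0%N).
(* [supremum] returns its default -oo only for the empty set; otherwise it picks from the set of
   suprema, which has at most one element. *)
rewrite /supremum ifF; last by apply/negbTE/set0P; exists (2%:Z%:E)%E; exact: A_ge2.
by have /is_subset1_supremums := @xgetPex _ -oo%E _ (ex_intro _ _ A_top); apply.
Qed.
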